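(* Let $b\ge 0$ and $c>0$ be real numbers. For all integers $g\ge 0$, $v\ge 1$, $n_1\ge 1$ and $n_2,\dots,n_v\ge 0$, the generalized $bc$-Motzkin numbers satisfy $$\widetilde{M}_{g,v}(n_1,n_2,\dots,n_v;b,c)-b\,\widetilde{M}_{g,v}(n_1-1,n_2,\dots,n_v;b,c)$$ $$=c^2\Bigg\{\sum_{j=2}^v n_j\,\widetilde{M}_{g,v-1}(n_1+n_j-2,n_2,\dots,\widehat{n_j},\dots,n_v;b,c)+\sum_{\zeta+\xi=n_1-2}\bigg[\widetilde{M}_{g-1,v+1}(\zeta,\xi,n_2,\dots,n_v;b,c)$$ $$+\sum_{g_1+g_2=g}\ \sum_{I\sqcup J=\{2,\dots,v\}}\widetilde{M}_{g_1,|I|+1}(\zeta,n_I;b,c)\,\widetilde{M}_{g_2,|J|+1}(\xi,n_J;b,c)\bigg]\Bigg\}.$$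
   Context: **Generalized Catalan numbers.** For $g\ge 0$, $v\ge 1$ and integers $\mu_i\ge 0$, $C_{g,v}(\mu_1,\dots,\mu_v)$ is the number of graphs drawn on the connected closed oriented surface of genus $g$ with $v$ labelled vertices, giving a cell decomposition of the surface, the $i$th vertex having degree $\mu_i$, with one half-edge at each vertex marked with an arrow (counted up to orientation-preserving homeomorphism preserving labels and arrows). They are symmetric in the $\mu_i$; $C_{0,1}(0)=1$; $C_{g,v}(\mu_1,\dots,\mu_v)=0$ if some $\mu_i=0$ and $(g,v)\ne(0,1)$; and they are determined by these values and, for $\mu_1\ge 1$, $$C_{g,v}(\mu_1,\dots,\mu_v)=\sum_{j=2}^v\mu_j C_{g,v-1}(\mu_1+\mu_j-2,\mu_2,\dots,\widehat{\mu_j},\dots,\mu_v)+\sum_{\alpha+\beta=\mu_1-2}\Big[C_{g-1,v+1}(\alpha,\beta,\mu_2,\dots,\mu_v)+\sum_{g_1+g_2=g,\ I\sqcup J=\{2,\dots,v\}}C_{g_1,|I|+1}(\alpha,\mu_I)\,C_{g_2,|J|+1}(\beta,\mu_J)\Big],$$ with $\alpha,\beta,g_1,g_2\ge 0$ and terms of negative genus equal to $0$. **Generalized $bc$-Motzkin numbers.** For $n_i\ge 0$, $$\widetilde{M}_{g,v}(n_1,\dots,n_v;b,c)=\sum_{\mu_1=0}^{n_1}\cdots\sum_{\mu_v=0}^{n_v}\binom{n_1}{\mu_1}\cdots\binom{n_v}{\mu_v}\,C_{g,v}(\mu_1,\dots,\mu_v)\,b^{(n_1+\cdots+n_v)-(\mu_1+\cdots+\mu_v)}c^{\mu_1+\cdots+\mu_v}$$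 (with $b^0=1$ also when $b=0$). **Notation.** $n_I=(n_{i_1},\dots,n_{i_{|I|}})$ for an index set $I$; $\widehat{n_j}$ means $n_j$ is deleted. The sums run over $\zeta,\xi\ge 0$, over $g_1,g_2\ge 0$, and over all ordered set partitions $I\sqcup J=\{2,\dots,v\}$ (empty sets allowed). Terms with negative genus are $0$, empty sums are $0$, and a term with coefficient $n_j=0$ is $0$. *)

(* Defs.v *)
From HB Require Import structures.
From mathcomp Require Import all_boot all_order all_algebra.
From mathcomp Require Import reals.

Set Implicit Arguments.
Unset Strict Implicit.
Unset Printing Implicit Defensive.

Import Order.TTheory GRing.Theory Num.Theory.

(* The surface is oriented, so the arrow at vertex i numbers the half-edges
   there: the arrowed one is (i, 0), and (i, k) is the k-th one met when turning
   counterclockwise from it.  Such a numbering is preserved by every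
   orientation-preserving homeomorphism that respects labels and arrows, so the
   homeomorphism classes of arrowed cell decompositions with vertex degrees mu
   correspond bijectively to the ways [a] of pairing the half-edges into edges
   that give a connected graph; the surface is recovered by gluing a disc along
   each boundary walk, i.e. each orbit of "cross the edge, then turn". *)
Section Graphs.
Variable mu : seq nat.

Definition half_edge : finType :=
  {i : 'I_(size mu) & 'I_(nth 0 mu i)}%type.

Definition turn (d : half_edge) : half_edge :=
  Tagged (fun i : 'I_(size mu) => 'I_(nth 0 mu i)) (ordS (tagged d)).

Definition is_pairing (a : {ffun half_edge -> half_edge}) : bool :=
  [forall d, (a d != d) && (a (a d) == d)].

Definition adjacent (a : {ffun half_edge -> half_edge}) : rel 'I_(size mu) :=
  fun i j => [exists d, (tag d == i) && (tag (a d) == j)].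

Definition connected_graph (a : {ffun half_edge -> half_edge}) : bool :=
  [forall i, forall j, connect (adjacent a) i j].

(* An isolated vertex carries no half-edge, but the graph reduced to one point
   still has one face on the sphere: hence the second summand. *)
Definition num_faces (a : {ffun half_edge -> half_edge}) : nat :=
  fcard (fun d => turn (a d)) predT + count_mem 0 mu.

Definition num_edges : nat := #|half_edge|./2.

(* V - E + F = 2 - 2g *)
Definition has_genus (g : nat) (a : {ffun half_edge -> half_edge}) : bool :=
  size mu + num_faces a + 2 * g == num_edges + 2.

End Graphs.

(* C_{g,v}(mu_1, ..., mu_v), where v = size mu (meaningful for v >= 1). *)
Definition catalan (g : nat) (mu : seq nat) : nat :=
  #|[set a : {ffun half_edge mu -> half_edge mu} |
      [&& is_pairing a, connected_graph a & has_genus g a]]|.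

Local Open Scope ring_scope.

(* sum_{mu_1 = 0}^{n_1} ... sum_{mu_v = 0}^{n_v} F(mu_1, ..., mu_v) *)
Fixpoint sum_upto (R : nmodType) (n : seq nat) (F : seq nat -> R) : R :=
  if n is m :: n' then \sum_(k < m.+1) sum_upto n' (fun mu => F (val k :: mu))
  else F [::].

(* M_{g,v}(n_1, ..., n_v; b, c), where v = size n. *)
Definition motzkin (R : realType) (b c : R) (g : nat) (n : seq nat) : R :=
  sum_upto n (fun mu =>
    (\prod_(i < size n) 'C(nth 0%N n i, nth 0%N mu i))%N%:R
    * (catalan g mu)%:R * b ^+ (sumn n - sumn mu) * c ^+ sumn mu).

(* The subsequence n_I; [enum I] lists I in increasing order. *)
Definition subtuple (n : seq nat) (I : {set 'I_(size n)}) : seq nat :=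
  [seq nth 0%N n (val i) | i <- enum I].

Definition delete_nth (n : seq nat) (j : nat) : seq nat :=
  take j n ++ drop j.+1 n.

(* M_{g-1,v}(n; b, c), which is 0 when the genus g - 1 is negative. *)
Definition motzkin_pred (R : realType) (b c : R) (g : nat) (n : seq nat) : R :=
  if g is g'.+1 then motzkin b c g' n else 0.

(* Main.v *)
Require Import Defs.
From mathcomp Require Import all_boot all_algebra all_fingroup.
From mathcomp Require Import reals zify ring.

Set Implicit Arguments.
Unset Strict Implicit.
Unset Printing Implicit Defensive.

Import GRing.Theory.

(** The proof has two independent halves: the numbers [catalan g mu] satisfy the
    recursion recalled for them, and this recursion is carried to the Motzkin
    numbers by the binomial transform.

    Contraction of an edge.  Let [s] turn around the vertices and let [a] exchange
    the two ends of each edge; the faces are then the cycles of [a * s].  Let [x]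
    be the arrowed half-edge of the first vertex and [y] its partner, and let
    t = (x y).  Writing a = t a' and s' = t s gives a s = a' s', so that
    replacing (s, a) by (s', a') keeps all the faces.  Here a' fixes [x] and [y],
    so the edge is gone, while s' differs from [s] in that the cycles of [x] and
    [y] are merged if they were distinct, and cut in two if [x] and [y] were on
    the same cycle.  In the second case the graph remains connected, with genus
    g - 1, or falls into two connected graphs whose genera add up to g.  This is
    [card_maps_contract].

    The half-edges [x] and [y] are not removed but stay in the cycles of s' as
    passive points.  Consequently all the systems live on one type, and a vertex
    of degree 0 is a cycle of passive points; it is also a cycle of a' s', so the
    face of an isolated vertex needs no special treatment.  The price is
    [catalan_maps]: the number of pairings depends only on how many active points
    each cycle contains.  The relabelling along first-return maps proves it.

    To distribute the genus over two pieces one has to know that the genus of each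
    piece is a natural number; [euler_exists] derives this from contraction too.

    Binomial transform.  The functional that takes [H] to the sum of
    'C(n, k) b^(n-k) c^k H(k) is the evaluation at 0 of the n-th power of the
    operator b + c * shift.  Its recursion turns the left-hand side of the theorem
    into c times a transform of [catalan g (k.+1 :: mu)].  After
    [catalan_recursion], a second factor c comes from [bt_natmul] and [bt_addn]
    for the merged vertices and from [bt_conv] for the cut ones; the sums over
    pairs of complementary sets of vertices factor by [mt_mask]. *)

(** * Rotation systems with passive points *)

Section Maps.
Variable T : finType.
Implicit Types (s a : {perm T}) (X Y Z S U A : {set T}) (x y : T).

Definition stable s X : bool := [forall x in X, s x \in X].

Lemma stableP s X : reflect {in X, forall x, s x \in X} (stable s X).
Proof. exact: forall_inP. Qed.

Lemma stableE s X x : stable s X -> (s x \in X) = (x \in X).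
Proof.
move=> /stableP sX.
have sXX : s @: X = X.
  apply/eqP; rewrite eqEcard card_imset ?leqnn ?andbT; last exact: perm_inj.
  by apply/subsetP=> _ /imsetP[y yX ->]; exact: sX.
by rewrite -{1}sXX mem_imset //; exact: perm_inj.
Qed.

Lemma stableI s X Y : stable s X -> stable s Y -> stable s (X :&: Y).
Proof.
by move=> sX sY; apply/stableP=> x /setIP[xX xY]; rewrite inE !stableE ?xX.
Qed.

Lemma stableC s X : stable s X -> stable s (~: X).
Proof. by move=> sX; apply/stableP=> x; rewrite !inE stableE. Qed.

Lemma stableD s X Y : stable s X -> stable s Y -> stable s (X :\: Y).
Proof. by move=> sX sY; rewrite setDE stableI ?stableC. Qed.

Lemma stableX s X n x : stable s X -> ((s ^+ n)%g x \in X) = (x \in X).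
Proof.
move=> sX; elim: n => [|n IHn]; first by rewrite expg0 perm1.
by rewrite expgSr permM stableE.
Qed.

Lemma stableM s a X : stable s X -> stable a X -> stable (s * a) X.
Proof. by move=> sX aX; apply/stableP=> x xX; rewrite permM !stableE. Qed.

Lemma stable_porbit s X x y : stable s X -> y \in porbit s x -> (y \in X) = (x \in X).
Proof. by move=> sX /porbitP[n ->]; exact: stableX. Qed.

Lemma stable_porbit_sub s X x : stable s X -> x \in X -> porbit s x \subset X.
Proof. by move=> sX xX; apply/subsetP=> y /(stable_porbit sX) ->. Qed.

Lemma porbit_stable s x : stable s (porbit s x).
Proof.
by apply/stableP=> y; rewrite -!eq_porbit_mem => /eqP <-; rewrite eq_porbit_mem
  (mem_porbit s 1).
Qed.

Lemma porbitE s x y : y \in porbit s x -> porbit s y = porbit s x.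
Proof. by rewrite -eq_porbit_mem => /eqP. Qed.

Lemma eq_stable s a X : {in X, s =1 a} -> stable s X = stable a X.
Proof. by move=> eqsa; apply: eq_forallb_in => x xX; rewrite eqsa. Qed.

Lemma eq_in_porbit s a X x : stable s X -> {in X, s =1 a} -> x \in X ->
  porbit s x = porbit a x.
Proof.
move=> sX eqsa xX; have E n : (s ^+ n)%g x = (a ^+ n)%g x.
  elim: n => [|n IHn]; first by rewrite !expg0.
  by rewrite !expgSr !permM -IHn eqsa // stableX.
by apply/setP=> y; apply/porbitP/porbitP=> -[n ->]; exists n; rewrite E.
Qed.

Definition ncyc s X := #|porbit s @: X|.

Lemma eq_ncyc s a X : stable s X -> {in X, s =1 a} -> ncyc s X = ncyc a X.
Proof.
by move=> sX eqsa; congr #|pred_of_set _|; apply: eq_in_imset => x /(eq_in_porbit sX eqsa).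
Qed.

Lemma ncycU s X Y : stable s X -> [disjoint X & Y] ->
  ncyc s (X :|: Y) = ncyc s X + ncyc s Y.
Proof.
move=> sX dXY; rewrite /ncyc imsetU cardsU -[RHS]subn0; congr (_ - _).
apply/eqP; rewrite cards_eq0 -subset0; apply/subsetP=> C.
case/setIP=> /imsetP[x xX ->] /imsetP[y yY] /eqP.
rewrite eq_porbit_mem porbit_sym => /(stable_porbit sX).
by rewrite xX (disjointFl dXY yY).
Qed.

Lemma ncycD s X Y : stable s Y -> Y \subset X ->
  ncyc s X = ncyc s Y + ncyc s (X :\: Y).
Proof.
move=> sY sYX; rewrite -ncycU //; last by rewrite disjoint_sym disjoints_subset subsetDr.
by rewrite -[X in LHS](setID _ Y) (setIidPr sYX).
Qed.

(** The effect of a transposition on the number of cycles is known for the whole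
    type; outside of [X] the two permutations agree, which localizes it. *)
Lemma ncyc_tperm s X x y : stable s X -> x \in X -> y \in X ->
  ncyc (tperm x y * s) X + (x \notin porbit s y).*2 = ncyc s X + (x != y).
Proof.
move=> sX xX yX; set t := tperm x y.
have tX : stable t X by apply/stableP=> z zX; rewrite /t; case: tpermP.
have := porbits_mul_tperm s x y; rewrite -/t /=.
have E a : stable a X -> #|porbits a| = ncyc a X + ncyc a (~: X).
  move=> aX; rewrite -setTD -ncycD ?subsetT //; congr #|pred_of_set _|.
  by apply/setP=> C; apply/imsetP/imsetP=> -[z _ ->]; exists z.
rewrite !E ?stableM // (@eq_ncyc (t * s) s (~: X)); first lia.
  by apply: stableC; exact: stableM.
move=> z; rewrite inE permM /t; case: tpermP => [->|->|//]; by rewrite ?xX ?yX.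
Qed.

(** A fixed point of [a] outside of [A] is a passive half-edge: it takes its turn
    around its vertex and belongs to no edge. *)
Definition pairing_on A a := [forall x, (a (a x) == x) && ((a x != x) == (x \in A))].

(** Transitivity on [X] of the group generated by [s] and [a], in the form that is
    convenient below: [X] is a minimal nonempty stable set. *)
Definition transitive_on X s a :=
  [&& X != set0, stable s X, stable a X &
    [forall S : {set T}, [&& S \subset X, stable s S & stable a S] ==> (S == set0) || (S == X)]].

(** The relation V - E + F = 2 - 2g multiplied by 2, because 2E = #|A|.  Composition
    is read from left to right, so [a * s] crosses an edge and then turns. *)
Definition euler X s A a g := 2 * (ncyc s X + ncyc (a * s) X) + 4 * g == #|A| + 4.

Definition is_map X s A g a := transitive_on X s a && euler X s A a g.

Definition maps X s A g := [set a | pairing_on A a && is_map X s A g a].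

Lemma transitiveP X s a :
  reflect [/\ X != set0, stable s X, stable a X &
    forall S : {set T}, S \subset X -> stable s S -> stable a S -> S = set0 \/ S = X]
    (transitive_on X s a).
Proof.
apply: (iffP and4P) => [] [X0 sX aX H]; split=> //.
  move=> S sSX sS aS; move/forallP: H => /(_ S); rewrite sSX sS aS /=.
  by case/orP=> /eqP; [left|right].
apply/forallP=> S; apply/implyP=> /and3P[sSX sS aS].
by case: (H S sSX sS aS) => ->; rewrite eqxx ?orbT.
Qed.

Lemma eq_transitive_on X s a a' : {in X, a =1 a'} ->
  transitive_on X s a = transitive_on X s a'.
Proof.
move=> E; rewrite /transitive_on (eq_stable E); congr [&& _, _, _ & _].
apply: eq_forallb => S; case: (boolP (S \subset X)) => //= sSX.
by rewrite (@eq_stable a a' S) // => x /(subsetP sSX)/E.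
Qed.

Lemma eq_euler X s A a a' g : stable s X -> stable a X -> {in X, a =1 a'} ->
  euler X s A a g = euler X s A a' g.
Proof.
move=> sX aX E; rewrite /euler (@eq_ncyc (a * s) (a' * s)) //; first exact: stableM.
by move=> x xX; rewrite !permM E.
Qed.

Lemma eq_is_map X s A g a a' : {in X, a =1 a'} -> is_map X s A g a = is_map X s A g a'.
Proof.
move=> E; rewrite /is_map -(eq_transitive_on s E).
by case: transitiveP => //= -[_ sX aX _]; exact: eq_euler.
Qed.

Lemma pairingK A a : pairing_on A a -> involutive a.
Proof. by move=> /forallP pa x; case/andP: (pa x) => /eqP. Qed.

Lemma pairing_neq A a x : pairing_on A a -> (a x != x) = (x \in A).
Proof. by move=> /forallP pa; case/andP: (pa x) => _ /eqP. Qed.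

Lemma pairing_out A a x : pairing_on A a -> x \notin A -> a x = x.
Proof. by move=> pa; rewrite -(pairing_neq _ pa) negbK => /eqP. Qed.

Lemma pairing_mem A a x : pairing_on A a -> (a x \in A) = (x \in A).
Proof.
by move=> pa; rewrite -!(pairing_neq _ pa) (pairingK pa) eq_sym.
Qed.

(** Contracting the edge {x, y} makes both of its ends passive, and this loses
    nothing but the edge itself. *)
Lemma pairing_tperm A a x y : x \in A -> y \in A -> x != y ->
  pairing_on A (tperm x y * a) && ((tperm x y * a)%g x == y)
  = pairing_on (A :\: [set x; y]) a.
Proof.
move=> xA yA nxy; apply/idP/idP.
  case/andP=> pa /eqP axy.
  have ayx : a x = y -> False.
    move=> E; have := pairing_neq y pa; rewrite permM tpermR E eqxx yA //.
  have axx : a x = x.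
    by have := pairingK pa x; rewrite axy permM tpermR.
  have ayy : a y = y by move: axy; rewrite permM tpermL.
  apply/forallP=> z; rewrite !inE.
  have [->|nzx] := eqVneq z x; first by rewrite !axx !eqxx.
  have [->|nzy] := eqVneq z y; first by rewrite !ayy !eqxx.
  have E : (tperm x y * a)%g z = a z by rewrite permM tpermD // eq_sym.
  have nax : a z != x by rewrite -{1}axx (inj_eq perm_inj).
  have nay : a z != y by rewrite -{1}ayy (inj_eq perm_inj).
  have E' : (tperm x y * a)%g (a z) = a (a z) by rewrite permM tpermD // eq_sym.
  move/forallP: pa => /(_ z); by rewrite E E'.
move=> pa.
have ax : a x = x by apply: (pairing_out pa); rewrite !inE eqxx.
have ay : a y = y by apply: (pairing_out pa); rewrite !inE eqxx orbT.
rewrite permM tpermL ay eqxx andbT; apply/forallP=> z; rewrite !permM.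
case: (tpermP x y z) => [->|->|/eqP nzx /eqP nzy].
- by rewrite ay tpermR ax eqxx xA (eq_sym y) nxy.
- by rewrite ax tpermL ay eqxx yA nxy.
have nax : a z != x by rewrite -{1}ax (inj_eq perm_inj).
have nay : a z != y by rewrite -{1}ay (inj_eq perm_inj).
rewrite tpermD 1?eq_sym // (pairingK pa) eqxx (pairing_neq _ pa).
by rewrite !inE (negbTE nzx) (negbTE nzy) eqxx.
Qed.

(** * Contraction of an edge and connectedness *)

Lemma stable_tperm s S x y : (x \in S) = (y \in S) ->
  stable (tperm x y * s) S = stable s S.
Proof.
move=> xyS; have tS : stable (tperm x y) S.
  by apply/stableP=> z; case: tpermP => // ->; rewrite xyS.
by apply/idP/idP=> [|]; [rewrite -{2}[s](tpermKg x y)|]; exact: stableM.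
Qed.

(** If [a] fixes [y], then [tperm x y * a] sends [x] to [y]. *)
Lemma stable_joined a S x y : a y = y -> stable (tperm x y * a) S ->
  (x \in S) = (y \in S).
Proof. by move=> ay aS; rewrite -(stableE x aS) permM tpermL ay. Qed.

Lemma porbit_merge s x y : y \notin porbit s x -> y \in porbit (tperm x y * s) x.
Proof.
move=> nyx; have nxy : x != y by apply: contraNneq nyx => ->; exact: porbit_id.
have := porbits_mul_tperm s x y; have := porbits_mul_tperm (tperm x y * s) x y.
rewrite /= tpermKg nxy ![x \in _]porbit_sym nyx.
by case: (y \in porbit (tperm x y * s) x) => //=; lia.
Qed.

Lemma porbit_split s x y : x != y -> y \in porbit s x ->
  y \notin porbit (tperm x y * s) x.
Proof.
move=> nxy yx.
have := porbits_mul_tperm s x y; have := porbits_mul_tperm (tperm x y * s) x y.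
rewrite /= tpermKg nxy ![x \in _]porbit_sym yx.
by case: (y \in porbit (tperm x y * s) x) => //=; lia.
Qed.

Lemma transitive_merge X s a x y : x \in X -> y \in X -> a x = x -> a y = y ->
  y \notin porbit s x ->
  transitive_on X s (tperm x y * a) = transitive_on X (tperm x y * s) a.
Proof.
move=> xX yX ax ay nyx.
have E (S : {set T}) : stable s S && stable (tperm x y * a) S =
    stable (tperm x y * s) S && stable a S.
  apply/andP/andP=> [] [sS aS].
    have xyS := stable_joined ay aS.
    by move: aS; rewrite !(stable_tperm _ xyS).
  have xyS : (x \in S) = (y \in S).
    by rewrite (stable_porbit sS (porbit_merge nyx)).
  by move: sS; rewrite !(stable_tperm _ xyS).
congr andb; rewrite !andbA E; congr andb.
by apply: eq_forallb => S; rewrite E.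
Qed.

(** A proper stable set for the contracted system must separate [x] from [y], since
    otherwise it would already be stable before the contraction.  If it
    contained a smaller one, that one or the difference would not separate [x]
    from [y]; hence the set and its complement in [X] are both minimal. *)
Lemma transitive_split X s a x y : a y = y ->
    transitive_on X s (tperm x y * a) ->
    ~~ transitive_on X (tperm x y * s) a ->
  exists Y : {set T}, [/\ [&& x \in Y, y \notin Y & Y \subset X],
    transitive_on Y (tperm x y * s) a & transitive_on (X :\: Y) (tperm x y * s) a].
Proof.
move=> ay /transitiveP[X0 sX aX tX].
have xyX := stable_joined ay aX.
have s'X : stable (tperm x y * s) X by rewrite stable_tperm.
have a'X : stable a X by rewrite -(stable_tperm a xyX).
have tX' (S : {set T}) : S \subset X -> stable (tperm x y * s) S -> stable a S ->
    (x \in S) = (y \in S) -> S = set0 \/ S = X.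
  move=> sSX sS aS xyS; apply: tX => //; first by rewrite -(stable_tperm s xyS).
  by rewrite (stable_tperm a xyS).
rewrite /transitive_on X0 s'X a'X /= => /forallPn[S].
rewrite negb_imply negb_or => /and3P[/and3P[sSX sS aS] S0 SX].
(* the complement of S in X has the same properties *)
wlog xS : S sSX sS aS S0 SX / x \in S.
  move=> H; have [|xS] := boolP (x \in S); first exact: H.
  have [xyS|nxyS] := eqVneq (x \in S) (y \in S).
    by case: (tX' S sSX sS aS xyS) => E; rewrite E eqxx in S0 SX.
  apply: (H (X :\: S)).
  - exact: subsetDl.
  - exact: stableD.
  - exact: stableD.
  - apply: contra_neq SX => /eqP; rewrite setD_eq0 => sXS.
    by apply/eqP; rewrite eqEsubset sSX.
  - apply: contra_neq S0 => E; apply/eqP; rewrite -subset0; apply/subsetP=> z zS.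
    by have := subsetP sSX z zS; rewrite -E inE zS.
  have yS : y \in S by move: nxyS; rewrite (negbTE xS); case: (y \in S).
  by rewrite inE xS xyX (subsetP sSX).
have yS : y \notin S.
  apply/negP=> yS; case: (tX' S sSX sS aS) => [|E|E]; first by rewrite xS yS.
    by rewrite E eqxx in S0.
  by rewrite E eqxx in SX.
have yX : y \in X by rewrite -xyX (subsetP sSX).
exists S; rewrite xS yS sSX; split=> //; apply/transitiveP; split=> //.
- move=> U sUS sU aU; have sUX := subset_trans sUS sSX.
  have yU : y \notin U by apply: contra yS; exact: (subsetP sUS).
  have [xU|xU] := boolP (x \in U); last first.
    case: (tX' U sUX sU aU) => [|E|E]; first by rewrite (negbTE xU) (negbTE yU).
      by left.
    by rewrite E yX in yU.
  have sD : S :\: U \subset X by rewrite (subset_trans (subsetDl _ _)).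
  case: (tX' (S :\: U) sD) => [||| E| E]; rewrite ?stableD //.
  - by rewrite !inE xU (negbTE yS) andbF.
  - by right; apply/eqP; rewrite eqEsubset sUS -setD_eq0 E eqxx.
  by have := yX; rewrite -E inE (negbTE yS) andbF.
- by apply/set0Pn; exists y; rewrite inE yS.
- exact: stableD.
- exact: stableD.
move=> U sU sU' aU.
have sUX := subset_trans sU (subsetDl _ _).
have sUS z : z \in U -> z \notin S by move/(subsetP sU); rewrite inE => /andP[].
have xU : x \notin U by apply: contraL xS => /sUS.
have [yU|yU] := boolP (y \in U); last first.
  case: (tX' U sUX sU' aU) => [|E|E]; first by rewrite (negbTE xU) (negbTE yU).
    by left.
  by rewrite E yX in yU.
right; apply/eqP; rewrite eqEsubset sU.
case: (tX' (X :\: S :\: U)) => [||||E|E].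
- by rewrite setDDl subsetDl.
- by rewrite !stableD.
- by rewrite !stableD.
- by rewrite !inE xS yU andbF.
- by rewrite -setD_eq0 E eqxx.
by have := yX; rewrite -E inE yU.
Qed.

Lemma transitive_unsplit X s a x y : x \in X -> y \in X -> a y = y ->
  transitive_on X (tperm x y * s) a -> transitive_on X s (tperm x y * a).
Proof.
move=> xX yX ay /transitiveP[X0 sX aX tX].
have xyX : (x \in X) = (y \in X) by rewrite xX yX.
apply/transitiveP; split=> //.
- by rewrite -(stable_tperm s xyX).
- by rewrite stable_tperm.
move=> S sSX sS aS; have xyS := stable_joined ay aS; apply: tX => //.
  by rewrite stable_tperm.
by rewrite -(stable_tperm a xyS).
Qed.

(** A set stable under the original system contains both of [x] and [y] or none,
    hence both pieces or none. *)
Lemma transitive_glue X Y s a x y : a y = y ->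
    [&& x \in Y, y \notin Y & Y \subset X] -> y \in X ->
    transitive_on Y (tperm x y * s) a -> transitive_on (X :\: Y) (tperm x y * s) a ->
  transitive_on X s (tperm x y * a).
Proof.
move=> ay /and3P[xY yY sYX] yX /transitiveP[_ sY aY tY] /transitiveP[_ sZ aZ tZ].
have xX := subsetP sYX _ xY.
have xyX : (x \in X) = (y \in X) by rewrite xX yX.
have EX : X = Y :|: (X :\: Y) 
  by apply/setP=> z; rewrite !inE; case: (boolP (z \in Y)) => //= /(subsetP sYX) ->.
have XU b : stable b Y -> stable b (X :\: Y) -> stable b X.
  by move=> /stableP bY /stableP bZ; rewrite EX; apply/stableP=> z /setUP[/bY|/bZ];
     rewrite !inE => H; rewrite ?H ?orbT //; case: (_ \in Y) H => //= ->.
apply/transitiveP; split=> //.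
- by apply/set0Pn; exists x.
- by rewrite -(stable_tperm s xyX) XU.
- by rewrite stable_tperm // XU.
move=> S sSX sS aS; have xyS := stable_joined ay aS.
have sS' : stable (tperm x y * s) S by rewrite stable_tperm.
have aS' : stable a S by rewrite -(stable_tperm a xyS).
have ES : S = (S :&: Y) :|: (S :&: (X :\: Y)).
  by rewrite -setIUr -EX (setIidPl sSX).
case: (tY (S :&: Y)) => [|||EY|EY]; rewrite ?subsetIr ?stableI //.
  case: (tZ (S :&: (X :\: Y))) => [|||EZ|EZ]; rewrite ?subsetIr ?stableI //.
    by left; rewrite ES EY EZ setU0.
  have xS : x \notin S by apply/negP=> xS; have := in_set0 x; rewrite -EY inE xS xY.
  have : y \in X :\: Y by rewrite inE yY.
  by rewrite -EZ inE -xyS (negbTE xS).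
case: (tZ (S :&: (X :\: Y))) => [|||EZ|EZ]; rewrite ?subsetIr ?stableI //.
  have yS : y \notin S by apply/negP=> yS; have := in_set0 y; rewrite -EZ !inE yS yY yX.
  by have := xY; rewrite -EY inE xyS (negbTE yS).
by right; rewrite ES EY EZ -EX.
Qed.

Lemma transitive_sub X Y s a : transitive_on X s a -> transitive_on Y s a ->
  Y \subset X -> Y = X.
Proof.
move=> /transitiveP[_ _ _ tX] /transitiveP[Y0 sY aY _] sYX.
by case: (tX Y) => // E; rewrite E eqxx in Y0.
Qed.

(** Distinct minimal stable sets are disjoint: a separating piece is determined by
    the half-edge that it contains. *)
Lemma transitive_unique Y Y' s a x : transitive_on Y s a -> transitive_on Y' s a ->
  x \in Y -> x \in Y' -> Y = Y'.
Proof.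
move=> /transitiveP[_ sY aY tY] /transitiveP[_ sY' aY' tY'] xY xY'.
have xI : x \in Y :&: Y' by rewrite inE xY.
have [E|E] : Y :&: Y' = set0 \/ Y :&: Y' = Y by apply: tY; rewrite ?subsetIl ?stableI.
  by rewrite E inE in xI.
have [E'|E'] : Y :&: Y' = set0 \/ Y :&: Y' = Y' by apply: tY'; rewrite ?subsetIr ?stableI.
  by rewrite E' inE in xI.
by rewrite -E E'.
Qed.

(** * Contraction of an edge and the genus *)

Lemma tperm_fixC a x y : a x = x -> a y = y -> (tperm x y * a = a * tperm x y)%g.
Proof.
move=> ax ay; apply/permP=> z; rewrite !permM -{1}ax -{1}ay.
by rewrite inj_tperm ?ax ?ay //; exact: perm_inj.
Qed.

Lemma card_setD2 A x y : x \in A -> y \in A -> x != y ->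
  #|A| = #|A :\: [set x; y]| + 2.
Proof.
move=> xA yA nxy; rewrite -(cardsID [set x; y] A) addnC; congr (_ + _).
have -> : A :&: [set x; y] = [set x; y].
  by apply/setIidPr/subsetP=> z /set2P[] ->.
by rewrite cards2 nxy.
Qed.

Lemma euler_uniq X s A a g g' : euler X s A a g -> euler X s A a g' = (g' == g).
Proof. by rewrite /euler => /eqP E; apply/eqP/eqP; lia. Qed.

Section Contract.
Variables (X A : {set T}) (s a : {perm T}) (x y : T).
Hypotheses (sX : stable s X) (sAX : A \subset X).
Hypotheses (xA : x \in A) (yA : y \in A) (nxy : x != y).
Let A' := A :\: [set x; y].
Let s' := (tperm x y * s)%g.
Hypothesis pa : pairing_on A' a.

Let ax : a x = x.
Proof. by apply: (pairing_out pa); rewrite !inE eqxx. Qed.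
Let ay : a y = y.
Proof. by apply: (pairing_out pa); rewrite !inE eqxx orbT. Qed.
Let xX : x \in X := subsetP sAX x xA.
Let yX : y \in X := subsetP sAX y yA.

(** Both sides of [a * s] absorb the same transposition: contracting an edge leaves
    the face permutation unchanged. *)
Lemma contract_faces : (tperm x y * a * s = a * s')%g.
Proof. by rewrite tperm_fixC // -mulgA. Qed.

(** Contracting an edge that is not a loop removes one vertex and one edge. *)
Lemma euler_merge g : y \notin porbit s x ->
  euler X s A (tperm x y * a) g = euler X s' A' a g.
Proof.
move=> nyx; rewrite /euler contract_faces (card_setD2 xA yA nxy).
have := ncyc_tperm sX xX yX; rewrite porbit_sym nyx nxy -/s' -/A'.
by move: (ncyc s' X) (ncyc s X) #|A'| => n' n k; clear => E; apply/eqP/eqP; lia.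
Qed.

Lemma is_map_merge g : y \notin porbit s x ->
  is_map X s A g (tperm x y * a) = is_map X s' A' g a.
Proof.
by move=> nyx; rewrite /is_map (transitive_merge xX yX ax ay nyx) euler_merge.
Qed.

Hypothesis yx : y \in porbit s x.

Lemma ncyc_split : ncyc s' X = (ncyc s X).+1.
Proof.
have := ncyc_tperm sX xX yX; rewrite porbit_sym yx nxy -/s' /=.
by rewrite addn0 addn1.
Qed.

(** Contracting a loop creates a vertex and removes an edge: if the result is
    connected, the genus drops by one. *)
Lemma euler_split g : euler X s A (tperm x y * a) g.+1 = euler X s' A' a g.
Proof.
rewrite /euler contract_faces (card_setD2 xA yA nxy) ncyc_split -/A'.
by move: (ncyc s X) #|A'| (ncyc _ X) => n k f; clear; apply/eqP/eqP; lia.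
Qed.

(** Contracting a loop adds 2 to V - E + F, and for a graph with two components this
    number is (2 - 2 g1) + (2 - 2 g2). *)
Lemma euler_glue Y g1 g2 : stable s' Y -> stable a Y -> Y \subset X ->
  euler Y s' (A' :&: Y) a g1 -> euler (X :\: Y) s' (A' :\: Y) a g2 ->
  euler X s A (tperm x y * a) (g1 + g2).
Proof.
move=> sY aY sYX; rewrite /euler contract_faces (card_setD2 xA yA nxy).
have := ncyc_split; rewrite (ncycD sY sYX) (ncycD (stableM aY sY) sYX).
rewrite -/A' -(cardsID Y A').
move: #|A' :&: Y| #|A' :\: Y| (ncyc s X) (ncyc (a * s') Y) (ncyc s' Y).
move: (ncyc s' (X :\: Y)) (ncyc (a * s') (X :\: Y)).
by clear; move=> > E /eqP E1 /eqP E2; apply/eqP; lia.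
Qed.

End Contract.

Lemma restr_perm_stableE Y a x : stable a Y -> restr_perm Y a x = if x \in Y then a x else x.
Proof.
move=> aY; case: ifP => [xY|/negbT xY].
  by apply: restr_permE => //; apply/astabsP=> z; rewrite /aperm /= stableE.
exact: (out_perm (restr_perm_on _ _)).
Qed.

Lemma pairing_restr A Y a : pairing_on A a -> stable a Y ->
  pairing_on (A :&: Y) (restr_perm Y a).
Proof.
move=> pa aY; apply/forallP=> x; rewrite inE !restr_perm_stableE//.
have [xY|xY] := boolP (x \in Y); last by rewrite (negbTE xY) !eqxx andbF.
by rewrite stableE // xY (pairingK pa) eqxx andbT (pairing_neq _ pa) eqxx.
Qed.

(** The genus of a connected graph is a natural number.  By contraction of an edge
    one reaches the one-point graph, and none of the three kinds of contraction
    can make an integral genus fractional or a nonnegative one negative. *)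
Lemma euler_exists X s A a : pairing_on A a -> A \subset X ->
  transitive_on X s a -> exists g, euler X s A a g.
Proof.
have [n] := ubnP #|A|; elim: n => // n IHn in X s A a *.
move=> An pa sAX tX; have [A0|[x xA]] := set_0Vmem A.
  have a1 : a = 1%g.
    by apply/permP=> z; rewrite perm1; apply: (pairing_out pa); rewrite A0 inE.
  exists 0; rewrite /euler a1 mul1g A0 cards0.
  case/transitiveP: tX => /set0Pn[x xX] sX aX tX.
  (* without edges, the graph is reduced to one vertex *)
  have -> : X = porbit s x.
    case: (tX (porbit s x)) => // [|||E].
    - exact: stable_porbit_sub.
    - exact: porbit_stable.
    - by apply/stableP=> z; rewrite a1 perm1.
    by have := porbit_id s x; rewrite E inE.
  have -> : ncyc s (porbit s x) = 1; last by [].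
  apply/eqP/cards1P; exists (porbit s x); apply/setP=> C; rewrite inE.
  apply/imsetP/eqP=> [[z zx ->]|->]; first exact: porbitE.
  by exists x => //; exact: porbit_id.
pose y := a x; have yA : y \in A by rewrite (pairing_mem _ pa).
have nxy : x != y by rewrite eq_sym (pairing_neq _ pa).
pose a' := (tperm x y * a)%g; pose s' := (tperm x y * s)%g.
have Ea : a = (tperm x y * a')%g by rewrite /a' tpermKg.
have pa' : pairing_on (A :\: [set x; y]) a'.
  by rewrite -pairing_tperm // -Ea pa eqxx.
have sX : stable s X by case/transitiveP: tX.
have sA'X : A :\: [set x; y] \subset X by rewrite (subset_trans (subsetDl _ _)).
have A'n : #|A :\: [set x; y]| < n by rewrite -ltnS (leq_trans _ An) // ltnS (card_setD2 xA yA nxy) addn2.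
have xX := subsetP sAX x xA; have yX := subsetP sAX y yA.
have a'x : a' x = x by apply: (pairing_out pa'); rewrite !inE eqxx.
have a'y : a' y = y by apply: (pairing_out pa'); rewrite !inE eqxx orbT.
have [yx|nyx] := boolP (y \in porbit s x); last first.
  move: tX; rewrite Ea (transitive_merge xX yX) // => /(IHn _ _ _ _ A'n pa' sA'X)[g eg].
  by exists g; rewrite (euler_merge sX).
have [tX'|ntX'] := boolP (transitive_on X s' a').
  have [g eg] := IHn _ _ _ _ A'n pa' sA'X tX'.
  by exists g.+1; rewrite Ea (euler_split sX).
move: (tX); rewrite Ea => tXa.
have [Y [/and3P[xY yY sYX] tY tZ]] := transitive_split a'y tXa ntX'.
have /transitiveP[_ sY aY _] := tY.
have /transitiveP[_ sZ aZ _] := tZ.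
have H U : stable a' U -> transitive_on U s' a' -> 
    exists g, euler U s' ((A :\: [set x; y]) :&: U) a' g.
  move=> aU tU; have E : {in U, a' =1 restr_perm U a'}.
    by move=> z zU; rewrite restr_perm_stableE ?zU.
  have [||||g eg] := IHn U s' ((A :\: [set x; y]) :&: U) (restr_perm U a').
  - by apply: leq_ltn_trans A'n; rewrite subset_leq_card ?subsetIl.
  - exact: pairing_restr.
  - exact: subsetIr.
  - by rewrite -(eq_transitive_on s' E).
  by exists g; rewrite (eq_euler _ _ _ aU E) //; case/transitiveP: tU.
have [g1 e1] := H Y aY tY; have [g2 e2] := H _ aZ tZ.
exists (g1 + g2); apply: (euler_glue sX sAX) (sY) (aY) sYX e1 _ => //.
by move: e2; rewrite setIDA (setIidPl sA'X).
Qed.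

(** * Counting by contraction *)

Lemma pairing_mul A B a b : pairing_on A a -> pairing_on B b -> [disjoint A & B] ->
  pairing_on (A :|: B) (a * b).
Proof.
move=> pa pb dAB.
have bA z : z \in A -> b z = z by move=> zA; rewrite (pairing_out pb) ?(disjointFr dAB zA).
have aB z : z \in B -> a z = z by move=> zB; rewrite (pairing_out pa) ?(disjointFl dAB zB).
apply/forallP=> z; rewrite inE !permM.
have [zA|zA] := boolP (z \in A).
  by rewrite (bA (a z)) ?(pairing_mem _ pa) // (pairingK pa) bA // eqxx (pairing_neq _ pa) zA.
rewrite (pairing_out pa zA) orFb; have [zB|zB] := boolP (z \in B).
  by rewrite (aB (b z)) ?(pairing_mem _ pb) // (pairingK pb) eqxx (pairing_neq _ pb) zB.
by rewrite (pairing_out pb zB) (pairing_out pa zA) (pairing_out pb zB) !eqxx.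
Qed.

(** A pairing that preserves [Y] and [Z] is the product of its restrictions. *)
Lemma card_maps_prod Y Z s A1 A2 g1 g2 :
  [disjoint Y & Z] -> A1 \subset Y -> A2 \subset Z ->
  #|maps Y s A1 g1| * #|maps Z s A2 g2| =
  #|[set a | pairing_on (A1 :|: A2) a && (is_map Y s A1 g1 a && is_map Z s A2 g2 a)]|.
Proof.
move=> dYZ sA1 sA2; rewrite -cardsX.
have dA : [disjoint A1 & A2] by rewrite (disjointWl sA1) // (disjointWr sA2).
have EY a b z : pairing_on A1 a -> pairing_on A2 b -> z \in Y -> (a * b)%g z = a z.
  move=> pa pb zY; rewrite permM; have [zA|zA] := boolP (z \in A1).
    by rewrite (pairing_out pb) // (disjointFr dA) // (pairing_mem _ pa).
  rewrite (pairing_out pa zA) (pairing_out pb) //.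
  by apply: contraFN (disjointFr dYZ zY); exact: (subsetP sA2).
have EZ a b z : pairing_on A1 a -> z \notin Y -> (a * b)%g z = b z.
  by move=> pa zY; rewrite permM (pairing_out pa) //; apply: contra zY; exact: (subsetP sA1).
pose f (ab : {perm T} * {perm T}) := (ab.1 * ab.2)%g.
rewrite -(card_in_imset (f := f)); last first.
  move=> [a b] [a' b']; rewrite !inE /= => /andP[/andP[pa _] /andP[pb _]] /andP[/andP[pa' _] /andP[pb' _]].
  move=> E0; have E : (a * b = a' * b')%g := E0.
  have Ea : a = a'.
    apply/permP=> z; have [zY|zY] := boolP (z \in Y).
      by rewrite -(EY a b) // E EY.
    have zA : z \notin A1 by apply: contra zY; exact: (subsetP sA1).
    by rewrite (pairing_out pa) ?(pairing_out pa').
  by move: E; rewrite Ea => /mulgI ->.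
apply: eq_card => c; rewrite inE; apply/imsetP/idP.
  case=> -[a b]; rewrite !inE /= => /andP[/andP[pa ma] /andP[pb mb]] ->.
  rewrite /f /= pairing_mul //=; apply/andP; split.
    by rewrite (@eq_is_map Y s A1 g1 _ a) // => z zY; exact: EY.
  by rewrite (@eq_is_map Z s A2 g2 _ b) // => z zZ; apply: EZ; rewrite // (disjointFl dYZ).
case/and3P=> pc mY mZ.
have cY : stable c Y by case/andP: mY => /transitiveP[].
have cZ : stable c Z by case/andP: mZ => /transitiveP[].
have IY : (A1 :|: A2) :&: Y = A1.
  apply/setP=> z; rewrite !inE; have [zA|zA] := boolP (z \in A1); first by rewrite (subsetP sA1).
  by apply/negP=> /andP[/(subsetP sA2) zZ]; rewrite (disjointFl dYZ zZ).
have IZ : (A1 :|: A2) :&: Z = A2.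
  apply/setP=> z; rewrite !inE; have [zA|zA] := boolP (z \in A2); first by rewrite orbT (subsetP sA2).
  rewrite orbF; apply/negP=> /andP[/(subsetP sA1) zY]; by rewrite (disjointFr dYZ zY).
(* the preimage of c is the pair of its restrictions *)
exists (restr_perm Y c, restr_perm Z c); last first.
  apply/permP=> z; rewrite /f permM !restr_perm_stableE //.
  have [zY|zY] := boolP (z \in Y).
    by rewrite (disjointFr dYZ) ?stableE.
  have [zZ //|zZ] := boolP (z \in Z).
  rewrite (pairing_out pc) // inE negb_or; apply/andP; split.
    by apply: contra zY; exact: (subsetP sA1).
  by apply: contra zZ; exact: (subsetP sA2).
have pY : pairing_on A1 (restr_perm Y c) by rewrite -{1}IY pairing_restr.
have pZ : pairing_on A2 (restr_perm Z c) by rewrite -{1}IZ pairing_restr.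
rewrite inE /= !inE pY pZ /=; apply/andP; split.
  by rewrite -(@eq_is_map Y s A1 g1 c) // => z zY; rewrite restr_perm_stableE ?zY.
by rewrite -(@eq_is_map Z s A2 g2 c) // => z zZ; rewrite restr_perm_stableE ?zZ.
Qed.

Lemma sum_antidiagonal (R : nmodType) n (F : nat -> nat -> R) :
  (\sum_(i < n.+1) \sum_(j < n.+1 | (i + j == n)%N) F i j = \sum_(i < n.+1) F i (n - i)%N)%R.
Proof.
apply: eq_bigr => i _.
have lt : n - i < n.+1 by rewrite ltnS leq_subr.
rewrite (big_pred1 (Ordinal lt)) // => j /=; rewrite -val_eqE /=.
by have := ltn_ord i; have := ltn_ord j => ? ?; apply/eqP/eqP; lia.
Qed.

Definition genus_pred (F : nat -> nat) g := if g is g'.+1 then F g' else 0.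

Definition separating X x y := [pred Y : {set T} | [&& x \in Y, y \notin Y & Y \subset X]].

(** The loop case for a single pairing.  Here [euler_exists] is what allows the
    genus to be distributed: each connected piece has a genus, so exactly one
    term of the right-hand side is nonzero when the left-hand side is. *)
Lemma is_map_split X A s a x y g : stable s X -> A \subset X -> x \in A -> y \in A ->
    x != y -> pairing_on (A :\: [set x; y]) a -> y \in porbit s x ->
  let s' := (tperm x y * s)%g in let A' := A :\: [set x; y] in
  is_map X s A g (tperm x y * a) =
    genus_pred (fun g' => is_map X s' A' g' a) g +
    \sum_(g1 < g.+1) \sum_(g2 < g.+1 | g1 + g2 == g) \sum_(Y | separating X x y Y)
       (is_map Y s' (A' :&: Y) g1 a * is_map (X :\: Y) s' (A' :\: Y) g2 a) :> nat.
Proof.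
move=> sX sAX xA yA nxy pa yx s' A'.
have xX := subsetP sAX x xA; have yX := subsetP sAX y yA.
have ay : a y = y by apply: (pairing_out pa); rewrite !inE eqxx orbT.
have sA'X : A' \subset X by rewrite (subset_trans (subsetDl _ _)).
rewrite (sum_antidiagonal g (fun g1 g2 => \sum_(Y | separating X x y Y)
       (is_map Y s' (A' :&: Y) g1 a * is_map (X :\: Y) s' (A' :\: Y) g2 a))).
have [tX'|ntX'] := boolP (transitive_on X s' a).
  have tX := transitive_unsplit xX yX ay tX'.
  rewrite big1 => [|g1 _]; last first.
    apply: big1 => Y /and3P[xY yY sYX]; rewrite /is_map.
    case tY : (transitive_on Y s' a) => //=.
    by have E := transitive_sub tX' tY sYX; rewrite E yX in yY.
  have [g0 eg0] := euler_exists pa sA'X tX'.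
  have eg0S : euler X s A (tperm x y * a) g0.+1 by rewrite (euler_split sX).
  rewrite addn0 /is_map tX (euler_uniq _ eg0S) /=; case: g => // g /=.
  by rewrite tX' (euler_uniq _ eg0).
have -> : genus_pred (fun g' => is_map X s' A' g' a) g = 0.
  by case: g => //= g; rewrite /is_map (negbTE ntX').
rewrite add0n; have [tX|ntX] := boolP (transitive_on X s (tperm x y * a)); last first.
  rewrite /is_map (negbTE ntX) big1 // => g1 _; apply: big1 => Y sepY.
  case tY : (transitive_on Y s' a) => //=; case tZ : (transitive_on (X :\: Y) s' a).
    by case/negP: ntX; exact: (transitive_glue ay sepY yX tY tZ).
  by rewrite muln0.
have [Y [sepY tY tZ]] := transitive_split ay tX ntX'.
have /and3P[xY yY sYX] := sepY.
have exg U : transitive_on U s' a -> U \subset X -> exists g1, euler U s' (A' :&: U) a g1.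
  move=> tU sUX; have [_ _ aU _] := transitiveP _ _ _ tU.
  have E : {in U, a =1 restr_perm U a} by move=> z zU; rewrite restr_perm_stableE ?zU.
  have [|||g1 eg1] := @euler_exists U s' (A' :&: U) (restr_perm U a).
  - exact: pairing_restr.
  - exact: subsetIr.
  - by rewrite -(eq_transitive_on s' E).
  by exists g1; rewrite (eq_euler _ _ _ aU E) //; case/transitiveP: tU.
have [h1 e1] := exg Y tY sYX; have [h2 e2] := exg _ tZ (subsetDl _ _).
rewrite setIDA (setIidPl sA'X) in e2.
have [_ sY aY _] := transitiveP _ _ _ tY.
have eg : euler X s A (tperm x y * a) (h1 + h2) by exact: (euler_glue sX sAX) e2.
rewrite {1}/is_map tX (euler_uniq _ eg) /=.
transitivity (\sum_(g1 < g.+1) ((val g1 == h1) && (g - g1 == h2))%N); last first.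
  apply: eq_bigr => g1 _; rewrite (bigD1 Y) //= big1 ?addn0 => [|U /andP[sepU nUY]].
    by rewrite /is_map tY tZ (euler_uniq _ e1) (euler_uniq _ e2) /= mulnb.
  rewrite {1}/is_map; case tU : (transitive_on U s' a) => //=.
  case/and3P: sepU => xU _ _.
  by rewrite (transitive_unique tU tY xU xY) eqxx in nUY.
have [le_h1|lt_g] := leqP h1 g; last first.
  rewrite (ltn_eqF (leq_trans lt_g (leq_addr h2 h1))) big1 // => g1 _.
  have le : g1 <= g by rewrite -ltnS.
  by rewrite (ltn_eqF (leq_ltn_trans le lt_g)).
rewrite (bigD1 (Ordinal (n := g.+1) (m := h1) le_h1)) //= big1 => [|g1]; last first.
  by rewrite -val_eqE /= => /negbTE->.
by rewrite eqxx addn0 /= -(eqn_add2l h1 (g - h1)) subnKC.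
Qed.

Lemma card_setE (P : pred {perm T}) A :
  #|[set a | pairing_on A a && P a]| = \sum_(a | pairing_on A a) P a.
Proof. by rewrite cardsE -sum1_card big_mkcondr. Qed.

(** Sum over the partner [y] of a given active half-edge [x], and contract the edge
    {x, y}. *)
Theorem card_maps_contract X s A g x : stable s X -> A \subset X -> x \in A ->
  #|maps X s A g| =
    \sum_(y in A | y \notin porbit s x) #|maps X (tperm x y * s) (A :\: [set x; y]) g|
  + \sum_(y in A | (y \in porbit s x) && (x != y))
     (genus_pred (fun g' => #|maps X (tperm x y * s) (A :\: [set x; y]) g'|) g
      + \sum_(g1 < g.+1) \sum_(g2 < g.+1 | g1 + g2 == g) \sum_(Y | separating X x y Y)
          #|maps Y (tperm x y * s) ((A :\: [set x; y]) :&: Y) g1|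
          * #|maps (X :\: Y) (tperm x y * s) ((A :\: [set x; y]) :\: Y) g2|).
Proof.
move=> sX sAX xA.
have E : #|maps X s A g| = \sum_(y in A | x != y)
    \sum_(a | pairing_on (A :\: [set x; y]) a) is_map X s A g (tperm x y * a)%g.
  rewrite /maps card_setE (partition_big (fun a : {perm T} => a x) (fun y => (y \in A) && (x != y))).
    apply: eq_bigr => y /andP[yA nxy].
    (* a pairing that exchanges x and y is tperm x y times one that fixes both *)
    rewrite (reindex_inj (mulgI (tperm x y))) /=; apply: eq_bigl => a.
    exact: pairing_tperm.
  by move=> a pa; rewrite (pairing_mem _ pa) xA eq_sym (pairing_neq _ pa).
rewrite {}E (bigID (fun y => y \notin porbit s x)) /=; congr (_ + _).
  apply: eq_big => [y|y].
    rewrite -andbA; congr andb; have [->|] := eqVneq x y; rewrite ?porbit_id //.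
  case/andP=> /andP[yA nxy] nyx; rewrite card_setE; apply: eq_bigr => a pa.
  by rewrite (is_map_merge sX sAX xA yA nxy pa).
apply: eq_big => [y|y]; first by rewrite negbK -andbA [(x != y) && _]andbC.
case/andP=> /andP[yA nxy]; rewrite negbK => yx.
under eq_bigr => a pa do rewrite (is_map_split g sX sAX xA yA nxy pa yx).
rewrite big_split /=; congr (_ + _).
  by case: g => [|g] /=; [rewrite big1|rewrite card_setE].
rewrite exchange_big; apply: eq_bigr => g1 _; rewrite exchange_big; apply: eq_bigr => g2 _.
rewrite exchange_big; apply: eq_bigr => Y /and3P[xY yY sYX].
set A' := A :\: [set x; y]; have sA'X : A' \subset X by rewrite (subset_trans (subsetDl _ _)).
rewrite card_maps_prod ?subsetIr ?setSD //; last by rewrite disjoint_sym disjoints_subset subsetDr.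
rewrite setID card_setE; apply: eq_bigr => a _; exact: mulnb.
Qed.
End Maps.

(** * First-return maps *)

Section FirstReturn.
Variable T : finType.
Implicit Types (s : {perm T}) (A : {set T}) (x y : T).

(** [y] is the first point of [A] met on the [s]-orbit of [x] after [x]. *)
Definition returns s A x y :=
  exists k, [/\ 0 < k, y = (s ^+ k)%g x & forall j, 0 < j < k -> (s ^+ j)%g x \notin A].

(** A first-return map has the same orbits on [A] as the map that it comes from:
    no point of [A] is skipped between two visits to [A].  The general form, along
    an injection [h], is used both for a return map inside one type and to compare
    two types. *)
Lemma returns_fconnect (U : finType) (B : {pred U}) (h : U -> T) (e : U -> U) s A :
  {in B &, injective h} -> {homo e : u / u \in B} ->
  {in B, forall u, h u \in A} -> {in B, forall u, returns s A (h u) (h (e u))} ->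
  {in B &, forall u u', fconnect e u u' = (h u' \in porbit s (h u))}.
Proof.
move=> hinj eB hA ret u u' uB u'B; apply/idP/idP.
  move=> /iter_findex <-; elim: (findex e u u') => [|n IHn] /=; first exact: porbit_id.
  have itB : iter n e u \in B by elim: n {IHn} => //= n IHn; exact: eB.
  have [k [_ -> _]] := ret _ itB.
  by rewrite -eq_porbit_mem porbit_perm eq_porbit_mem.
case/porbitP=> n; have [m] := ubnP n; elim: m => // m IHm in n u uB *.
move=> nm E; case: n => [|n] in nm E *.
  by move: E; rewrite expg0 perm1 => /(hinj _ _ u'B uB) ->.
have [k [k0 hk nA]] := ret u uB.
have kn : k <= n.+1.
  rewrite leqNgt; apply/negP=> lt; have := nA n.+1 lt; by rewrite -E hA.
apply: (connect_trans (fconnect1 e u)).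
apply: (IHm (n.+1 - k)) => //; first exact: eB.
  by apply: (@leq_trans n.+1); [rewrite ltn_subrL k0 | rewrite -ltnS].
by rewrite hk -permM -expgD subnKC.
Qed.

Lemma card_porbits_fcard (U : finType) (h : U -> T) (e : U -> U) s (M : {set T}) :
  (forall u u', fconnect e u u' = (h u' \in porbit s (h u))) ->
  (forall u, h u \in M) -> {in M, forall x, exists u, h u \in porbit s x} ->
  ncyc s M = fcard e predT.
Proof.
move=> con hM Mh.
have sym : connect_sym (frel e) by move=> u u'; rewrite !con porbit_sym.
rewrite /ncyc /n_comp_mem.
rewrite -(card_in_imset (f := fun u => porbit s (h u))); last first.
  move=> u u' /andP[/eqP ru _] /andP[/eqP ru' _] /eqP.
  rewrite eq_porbit_mem porbit_sym -con => /(fingraph.rootP sym).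
  by rewrite ru ru'.
apply: eq_card => C; apply/imsetP/imsetP=> [[x xM ->]|[u _ ->]]; last by exists (h u).
have [u ux] := Mh x xM; exists (froot e u); first by rewrite inE /= (roots_root sym).
by rewrite -(porbitE ux); apply/esym/porbitE; rewrite -con connect_root.
Qed.

Section Rho.
Variables (s : {perm T}) (A : {set T}).

(** The search stops before the order of [s], whose power brings [x] back to [A]. *)
Definition first_return x :=
  if x \in A then (s ^+ (find (fun n => (s ^+ n.+1)%g x \in A) (iota 0 #[s]%g)).+1)%g x else x.

Lemma first_returnP x : x \in A -> first_return x \in A /\ returns s A x (first_return x).
Proof.
move=> xA; rewrite /first_return xA; set p := fun n => _; set l := iota _ _.
have hp : has p l.
  apply/hasP; exists #[s]%g.-1; first by rewrite mem_iota /= add0n prednK // order_gt0.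
  by rewrite /p prednK ?order_gt0 // expg_order perm1.
have lt : find p l < #[s]%g by move: hp; rewrite has_find size_iota.
split; first by have := nth_find 0 hp; rewrite nth_iota.
exists (find p l).+1; split=> // -[//|j] /= ltj.
have := before_find 0 (s := l) (a := p) (i := j) ltj.
by rewrite nth_iota ?add0n /p => [->//|]; exact: ltn_trans lt.
Qed.

Lemma first_return_inj : injective first_return.
Proof.
have aux x y k m : x \in A -> (s ^+ k)%g x = (s ^+ m)%g y -> k <= m ->
    0 < k -> (forall j, 0 < j < m -> (s ^+ j)%g y \notin A) -> x = y.
  move=> xA + km k0 nA; rewrite -(subnK km) expgD permM => /perm_inj E.
  have [lt|ge] := ltnP k m.
    have := nA (m - k); rewrite -E xA subn_gt0 lt ltn_subrL k0.
    by rewrite (ltn_trans k0 lt) => /(_ isT).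
  by have /eqP e0 : m - k == 0; [rewrite subn_eq0 | rewrite E e0 expg0 perm1].
move=> x y E.
have [xA|xA] := boolP (x \in A); last first.
  have Ex : first_return x = x by rewrite /first_return (negbTE xA).
  have [yA|yA] := boolP (y \in A).
    by have [] := first_returnP yA; rewrite -E Ex (negbTE xA).
  by move: E; rewrite Ex /first_return (negbTE yA).
have [yA|yA] := boolP (y \in A); last first.
  by have [] := first_returnP xA; rewrite E /first_return !(negbTE yA).
have [_ [k [k0 Ek nk]]] := first_returnP xA.
have [_ [m [m0 Em nm]]] := first_returnP yA.
move: E; rewrite Ek Em => E.
case: (leqP k m) => [|/ltnW] le; first exact: (aux x y k m).
by apply/esym; exact: (aux y x m k).
Qed.

Definition return_perm := perm first_return_inj.

Lemma return_permP x : x \in A -> return_perm x \in A /\ returns s A x (return_perm x).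
Proof. by rewrite permE; exact: first_returnP. Qed.

Lemma porbit_return x : x \in A -> porbit return_perm x = porbit s x :&: A.
Proof.
move=> xA.
have st : stable return_perm A by apply/stableP=> y /return_permP[].
apply/setP=> y; rewrite inE; have [yA|yA] := boolP (y \in A); last first.
  by rewrite andbF; apply: contraNF yA => /(stable_porbit st) ->.
rewrite andbT -(returns_fconnect (B := A) (e := return_perm) (h := id) (s := s) (A := A)) //.
- apply/porbitP/idP => [[n ->]|/iter_findex <-].
    by rewrite permX fconnect_iter.
  by exists (findex return_perm x y); rewrite permX.
- by move=> z /return_permP[].
by move=> z /return_permP[].
Qed.

End Rho.
End FirstReturn.

(** * Removal of passive points *)

Section Bridge.
Variables (T : finType) (X A : {set T}) (s : {perm T}) (cs : seq {set T}).
Hypotheses (sX : stable s X) (sAX : A \subset X) (X0 : X != set0).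
Hypotheses (cs_uniq : uniq cs) (csE : cs =i porbit s @: X).

(** The degree of a vertex, i.e. of a cycle of [s], counts its active points. *)
Definition degrees := [seq #|C :&: A| | C <- cs].
Local Notation mu := degrees.
Local Notation vertex := 'I_(size mu).

Definition cycle_at (i : nat) := nth set0 cs i.

Lemma size_degrees : size mu = size cs. Proof. exact: size_map. Qed.

Lemma ltn_vertex (i : vertex) : i < size cs.
Proof. by rewrite -size_degrees. Qed.

Lemma nth_degrees (i : vertex) : nth 0 mu i = #|cycle_at i :&: A|.
Proof. by rewrite (nth_map set0) // ltn_vertex. Qed.

Lemma cycle_atE (i : vertex) x : x \in cycle_at i -> cycle_at i = porbit s x /\ x \in X.
Proof.
have : cycle_at i \in cs by rewrite mem_nth ?ltn_vertex.
rewrite csE => /imsetP[z zX ->] xz; split; first by rewrite (porbitE xz).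
by rewrite (stable_porbit sX xz).
Qed.

Lemma cycle_at_inj (i j : vertex) x : x \in cycle_at i -> x \in cycle_at j -> i = j.
Proof.
move=> /cycle_atE[Ei _] /cycle_atE[Ej _]; apply: val_inj; apply/eqP => /=.
by rewrite -(nth_uniq set0 (ltn_vertex i) (ltn_vertex j) cs_uniq) -/(cycle_at i) Ei -Ej.
Qed.

Lemma cycle_at_ex x : x \in X -> exists i : vertex, x \in cycle_at i.
Proof.
move=> xX; have : porbit s x \in cs by rewrite csE imset_f.
move=> mem; have lt : index (porbit s x) cs < size mu by rewrite size_degrees index_mem.
by exists (Ordinal lt); rewrite /cycle_at /= nth_index // porbit_id.
Qed.

Lemma ncyc_size : ncyc s X = size mu.
Proof. by rewrite /ncyc -(eq_card csE) size_degrees; apply/card_uniqP. Qed.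

Definition base (i : vertex) := odflt (xchoose (set0Pn X X0)) [pick x in cycle_at i :&: A].

Lemma baseP (i : vertex) (k : 'I_(nth 0 mu i)) : base i \in cycle_at i :&: A.
Proof.
rewrite /base; case: pickP => [//|no] /=.
have := leq_ltn_trans (leq0n k) (ltn_ord k).
by rewrite nth_degrees (eq_card0 no).
Qed.

Local Notation rho := (return_perm s A).

(** The half-edges at vertex [i] are numbered along the return map of [A], which
    skips passive points. *)
Definition place (d : half_edge mu) : T := (rho ^+ (tagged d))%g (base (tag d)).

Lemma porbit_base (i : vertex) (k : 'I_(nth 0 mu i)) :
  porbit rho (base i) = cycle_at i :&: A.
Proof.
by have /setIP[bC bA] := baseP k; rewrite porbit_return // (cycle_atE bC).1.
Qed.

Lemma place_cycle (d : half_edge mu) : place d \in cycle_at (tag d) :&: A.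
Proof. by rewrite -(porbit_base (tagged d)) mem_porbit. Qed.

Lemma place_A d : place d \in A.
Proof. by have /setIP[] := place_cycle d. Qed.

Lemma place_X d : place d \in X.
Proof. exact: (subsetP sAX _ (place_A d)). Qed.

Lemma place_turn d : place (turn d) = rho (place d).
Proof.
case: d => i k; rewrite /place /turn /= -[RHS]permM -expgSr.
have [lt|ge] := ltnP k.+1 (nth 0 mu i); first by rewrite modn_small.
have -> : k.+1 = nth 0 mu i by apply/eqP; rewrite eqn_leq ge ltn_ord.
by rewrite modnn expg0 perm1 nth_degrees -(porbit_base k) permX iter_porbit.
Qed.

Lemma place_inj : injective place.
Proof.
move=> d d' E; have /setIP[dC _] := place_cycle d; have /setIP[dC' _] := place_cycle d'.
rewrite -E in dC'; have Et := cycle_at_inj dC dC'.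
case: d d' E Et {dC dC'} => i k [i' k'] /= E Et; subst i'; congr existT.
apply: val_inj => /=; move: E; rewrite /place /= !permX.
have ltk (l : 'I_(nth 0 mu i)) : l < #|porbit rho (base i)|.
  by rewrite (porbit_base k) -nth_degrees.
rewrite -!(nth_traject rho (ltk _)) => /eqP.
by rewrite nth_uniq ?size_traject ?uniq_traject_porbit ?ltk // => /eqP.
Qed.

Lemma place_surj x : x \in A -> exists d, place d = x.
Proof.
move=> xA; have [i xi] := cycle_at_ex (subsetP sAX x xA).
have mi : 0 < nth 0 mu i.
  by rewrite nth_degrees card_gt0; apply/set0Pn; exists x; rewrite inE xi.
have : x \in porbit rho (base i) by rewrite (porbit_base (Ordinal mi)) inE xi.
rewrite porbit_traject (porbit_base (Ordinal mi)) -nth_degrees => /trajectP[k ltk ->].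
by exists (existT _ i (Ordinal ltk)); rewrite /place /= permX.
Qed.

Lemma card_half_edge : #|half_edge mu| = #|A|.
Proof.
rewrite -cardsT -(card_imset _ place_inj); apply: eq_card => x.
apply/imsetP/idP => [[d _ ->]|/place_surj[d <-]]; first exact: place_A.
by exists d.
Qed.

Section Map.
Variables (a : {ffun half_edge mu -> half_edge mu}) (b : {perm T}).
Hypothesis pb : pairing_on A b.
Hypothesis ab : forall d, place (a d) = b (place d).

Lemma bridge_pairing : is_pairing a.
Proof.
apply/forallP=> d; rewrite -!(inj_eq place_inj) !ab (pairingK pb) eqxx andbT.
by rewrite (pairing_neq _ pb) place_A.
Qed.

(** From the image of [d], the walk [b * s] crosses the edge of [d] and then turns
    past passive points only, until it reaches the next half-edge of the face. *)
Lemma bridge_returns d : returns (b * s) A (place d) (place (turn (a d))).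
Proof.
have [_ [k [k0 Ek nk]]] := return_permP s (place_A (a d)).
have H j : j < k -> ((b * s) ^+ j.+1)%g (place d) = (s ^+ j.+1)%g (place (a d)).
  elim: j => [|j IHj] lt; first by rewrite !expg1 permM ab.
  rewrite expgSr permM IHj 1?ltnW // permM (pairing_out pb); last exact: nk.
  by rewrite -permM -expgSr.
exists k; split=> //; first by rewrite place_turn Ek -(prednK k0) H ?prednK.
by case=> [//|j] /= lt; rewrite H ?nk // ltnW.
Qed.

Lemma bridge_fconnect d d' :
  fconnect (fun d => turn (a d)) d d' = (place d' \in porbit (b * s) (place d)).
Proof.
apply: (returns_fconnect (B := predT) (A := A)) => //.
- by move=> u v _ _; exact: place_inj.
- by move=> u _; exact: place_A.
by move=> u _; exact: bridge_returns.
Qed.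

(** The cycles of [b * s] that meet [A] are the boundary walks; the others are the
    cycles of [s] without active point, which are the isolated vertices. *)
Lemma bridge_faces : stable b X -> num_faces a = ncyc (b * s) X.
Proof.
move=> bX; pose N := [set x in X | porbit s x :&: A == set0].
have sN : stable s N.
  apply/stableP=> x; rewrite !inE => /andP[xX xA]; rewrite stableE // xX /=.
  by rewrite (porbitE (x := x)) // (mem_porbit s 1).
have NA x : x \in N -> x \notin A.
  rewrite inE => /andP[_ /eqP E]; apply/negP=> xA.
  by have := in_set0 x; rewrite -E inE xA porbit_id.
have eqN : {in N, s =1 (b * s)%g} by move=> x xN; rewrite permM (pairing_out pb) // NA.
have fN : stable (b * s) N by rewrite -(eq_stable eqN).
have sNX : N \subset X by apply/subsetP=> x; rewrite inE => /andP[].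
rewrite /num_faces (ncycD fN sNX) -(eq_ncyc sN eqN) addnC; congr (_ + _).
  rewrite count_map /ncyc -size_filter -(card_uniqP (filter_uniq _ cs_uniq)).
  apply: eq_card => C; rewrite mem_filter csE /= eq_sym.
  apply/andP/imsetP=> [[C0 /imsetP[x xX EC]]|[x]].
    by exists x => //; rewrite inE xX -EC -cards_eq0 eq_sym.
  rewrite inE => /andP[xX /eqP E] ->; split; last exact: imset_f.
  by rewrite E cards0.
apply/esym/(card_porbits_fcard (h := place)).
- exact: bridge_fconnect.
- move=> d; rewrite inE place_X andbT; apply/negP=> /NA; by rewrite place_A.
move=> x; rewrite inE => /andP[xN xX].
have [E|[y /setIP[yx yA]]] := set_0Vmem (porbit (b * s) x :&: A); last first.
  by have [d Ed] := place_surj yA; exists d; rewrite Ed.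
case/negP: xN; rewrite inE xX /= -E; apply/eqP; congr (_ :&: _).
apply/esym/(eq_in_porbit (X := porbit (b * s) x)); rewrite ?porbit_id ?porbit_stable //.
move=> y yx; rewrite permM (pairing_out pb) //; apply/negP=> yA.
by have := in_set0 y; rewrite -E inE yx yA.
Qed.

Lemma bridge_stable : stable b X.
Proof.
apply/stableP=> x xX; have [xA|xA] := boolP (x \in A).
  by apply: (subsetP sAX); rewrite (pairing_mem _ pb).
by rewrite (pairing_out pb).
Qed.

Lemma bridge_connected : connected_graph a = transitive_on X s b.
Proof.
apply/idP/transitiveP=> [con|[_ _ bX tX]].
  split=> //; first exact: bridge_stable.
  move=> S sSX sS bS; have [->|[x xS]] := set_0Vmem S; [by left|right].
  have CS (i : vertex) y : y \in cycle_at i -> y \in S -> cycle_at i \subset S.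
    by move=> yi yS; rewrite (cycle_atE yi).1 stable_porbit_sub.
  have xX := subsetP sSX x xS; have [i xi] := cycle_at_ex xX.
  apply/eqP; rewrite eqEsubset sSX; apply/subsetP=> y /cycle_at_ex[j yj].
  (* follow a path of vertices from a cycle that meets S *)
  suff: cycle_at j \subset S by move/subsetP/(_ y yj).
  have /forallP/(_ i)/forallP/(_ j)/connectP[p] := con.
  elim: p => [|k p IHp] /= in i x xS {xX} xi *; first by move=> _ ->; exact: CS xi xS.
  case/andP=> /existsP[d /andP[/eqP di /eqP dk]]; apply: (IHp k (place (a d))).
    rewrite ab stableE //; have /setIP[dC _] := place_cycle d.
    by rewrite di in dC; exact: (subsetP (CS i x xi xS)).
  by have /setIP[] := place_cycle (a d); rewrite dk.
apply/forallP=> i; apply/forallP=> j.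
have Cne (l : vertex) : exists x, x \in cycle_at l.
  have : cycle_at l \in cs by rewrite mem_nth ?ltn_vertex.
  by rewrite csE => /imsetP[z _ ->]; exists z; exact: porbit_id.
(* the points lying over the connected component of vertex i *)
pose S := \bigcup_(l | connect (adjacent a) i l) cycle_at l.
have [|||E|E] := tX S.
- apply/bigcupsP=> l _; apply/subsetP=> x xl; exact: (cycle_atE xl).2.
- apply/stableP=> x /bigcupP[l il xl]; apply/bigcupP; exists l => //.
  by move: (xl); rewrite (cycle_atE xl).1 (stableE _ (porbit_stable _ _)).
- apply/stableP=> x /bigcupP[l il xl]; have [xA|xA] := boolP (x \in A); last first.
    by rewrite (pairing_out pb xA); apply/bigcupP; exists l.
  have [d Ed] := place_surj xA; have /setIP[dC _] := place_cycle d.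
  have /setIP[adC _] := place_cycle (a d).
  rewrite Ed in dC; have El := cycle_at_inj dC xl.
  apply/bigcupP; exists (tag (a d)); last by rewrite -Ed -ab.
  apply: connect_trans il (connect1 _); apply/existsP; exists d.
  by rewrite El !eqxx.
- have [x xi] := Cne i; have := in_set0 x; rewrite -E => /bigcupP[].
  by exists i; rewrite ?connect0.
have [y yj] := Cne j; have : y \in S by rewrite E; exact: (cycle_atE yj).2.
by case/bigcupP=> l il yl; rewrite (cycle_at_inj yj yl).
Qed.

(** [has_genus] halves the number of half-edges; this is harmless because
    [euler_exists] shows it to be even. *)
Lemma bridge_genus g : connected_graph a -> has_genus g a = euler X s A b g.
Proof.
rewrite bridge_connected => tX.
have [g0] := euler_exists pb sAX tX.
rewrite /has_genus /euler /num_edges card_half_edge bridge_faces ?bridge_stable // ncyc_size.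
move: (ncyc _ _) (size _) #|A|; clear => f v e /eqP E0.
by have -> : e./2 = v + f + 2 * g0 - 2 by [lia]; apply/eqP/eqP; lia.
Qed.
End Map.

(** The number of maps on a system with passive points depends only on the active
    degrees of the vertices: passive points can be skipped in every cycle. *)
Theorem catalan_maps g : catalan g mu = #|maps X s A g|.
Proof.
pose G (b : {perm T}) : {ffun half_edge mu -> half_edge mu} :=
  [ffun d => odflt d [pick d' | place d' == b (place d)]].
have GE b d : pairing_on A b -> place (G b d) = b (place d).
  move=> pb; rewrite ffunE; case: pickP => [d' /eqP //|no].
  have [|d' Ed'] := @place_surj (b (place d)); first by rewrite (pairing_mem _ pb) place_A.
  by have := no d'; rewrite Ed' eqxx.
rewrite /catalan -(card_in_imset (f := G) (D := maps X s A g)); last first.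
  move=> b b'; rewrite !inE => /andP[pb _] /andP[pb' _] E; apply/permP=> x.
  have [xA|xA] := boolP (x \in A); last by rewrite (pairing_out pb) ?(pairing_out pb').
  by have [d <-] := place_surj xA; rewrite -!GE // E.
apply: eq_card => a; rewrite inE; apply/idP/imsetP.
  case/and3P=> pa ca ga.
  (* transport a to A, and extend it by the identity *)
  pose f x := if [pick d | place d == x] is Some d then place (a d) else x.
  have fE d : f (place d) = place (a d).
    rewrite /f; case: pickP => [d' /eqP/place_inj-> //|/(_ d)]; by rewrite eqxx.
  have fout x : x \notin A -> f x = x.
    by move=> xA; rewrite /f; case: pickP => // d /eqP E; rewrite -E place_A in xA.
  have aP d : a d != d /\ a (a d) = d by have /forallP/(_ d)/andP[? /eqP] := pa.
  have fK : involutive f.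
    move=> x; have [/place_surj[d <-]|xA] := boolP (x \in A); last by rewrite !fout.
    by rewrite !fE (aP d).2.
  pose b := perm (inv_inj fK).
  have pb : pairing_on A b.
    apply/forallP=> x; rewrite !permE fK eqxx /=.
    have [/place_surj[d <-]|xA] := boolP (x \in A); last by rewrite fout ?eqxx.
    by rewrite fE (inj_eq place_inj) (aP d).1.
  have ab d : place (a d) = b (place d) by rewrite permE fE.
  exists b; last by apply/ffunP=> d; apply: place_inj; rewrite GE.
  by rewrite inE pb /is_map -(bridge_connected pb ab) ca /= -(bridge_genus pb ab).
case=> b; rewrite inE => /andP[pb /andP[tb eb]] ->.
have ab d := GE b d pb.
have cb : connected_graph (G b) by rewrite (bridge_connected pb ab).
by rewrite (bridge_pairing pb ab) cb (bridge_genus pb ab).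
Qed.

End Bridge.

(** * Lists of vertices under contraction *)

Section CycleLists.
Variable T : finType.
Implicit Types (s : {perm T}) (A B Y C : {set T}) (L : seq {set T}) (x y z : T).

(** An ordered list of vertices; the order is that of the arguments of [catalan]. *)
Definition cycle_list s L := uniq L && all (mem (porbits s)) L.

Definition cover_of L := [set z | has (fun C : {set T} => z \in C) L].

Lemma cover_ofP L z : reflect (exists2 C, C \in L & z \in C) (z \in cover_of L).
Proof. by rewrite inE; exact: hasP. Qed.

Lemma cycle_listP s L C z : cycle_list s L -> C \in L -> z \in C -> C = porbit s z.
Proof.
by move=> /andP[_ /allP H] /H /imsetP[y _ ->] /porbitE.
Qed.

Lemma cover_stable s L : cycle_list s L -> stable s (cover_of L).
Proof.
move=> cL; apply/stableP=> z /cover_ofP[C CL zC]; apply/cover_ofP; exists C => //.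
by move: (zC); rewrite (cycle_listP cL CL zC) stableE ?porbit_stable.
Qed.

Lemma cover_cycles s L : cycle_list s L -> L =i porbit s @: cover_of L.
Proof.
move=> cL C; apply/idP/imsetP => [CL|[z /cover_ofP[C' CL zC] ->]].
  have /andP[_ /allP/(_ C CL)/imsetP[z _ EC]] := cL.
  by exists z => //; apply/cover_ofP; exists C; rewrite // EC porbit_id.
by rewrite -(cycle_listP cL CL zC).
Qed.

Lemma catalan_cycle_list s A C L g : cycle_list s (C :: L) -> A \subset cover_of (C :: L) ->
  #|maps (cover_of (C :: L)) s A g| = catalan g (degrees A (C :: L)).
Proof.
move=> cL sA; apply/esym/catalan_maps => //.
- exact: cover_stable.
- have /andP[_ /allP/(_ C (mem_head _ _))/imsetP[z _ EC]] := cL.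
  by apply/set0Pn; exists z; apply/cover_ofP; exists C; rewrite ?mem_head // EC porbit_id.
- by case/andP: cL.
exact: cover_cycles.
Qed.

Lemma cycle_list_uniq s L C C' z : cycle_list s L -> C \in L -> C' \in L -> z \in C ->
  z \in C' -> C = C'.
Proof.
by move=> cL CL CL' zC zC'; rewrite (cycle_listP cL CL zC) (cycle_listP cL CL' zC').
Qed.

Definition remove_at (U : Type) (l : seq U) j := take j l ++ drop j.+1 l.

Lemma remove_at_rem (U : eqType) (u0 : U) (l : seq U) j : uniq l -> j < size l ->
  remove_at l j = rem (nth u0 l j) l.
Proof. by move=> ul jl; rewrite remE index_uniq. Qed.

Lemma map_remove_at (U V : Type) (f : U -> V) l j :
  map f (remove_at l j) = remove_at (map f l) j.
Proof. by rewrite /remove_at map_cat map_take map_drop. Qed.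

Lemma degrees_cover A B L : cover_of L \subset B -> degrees (A :&: B) L = degrees A L.
Proof.
move=> sB; apply/eq_in_map=> C CL; apply: eq_card => z; rewrite !inE.
have [zC|//] := boolP (z \in C).
by rewrite (subsetP sB z) ?andbT //; apply/cover_ofP; exists C.
Qed.

Section Contraction.
Variables (s : {perm T}) (A C0 : {set T}) (Cs : seq {set T}) (x y : T).
Hypotheses (cL : cycle_list s (C0 :: Cs)) (xC : x \in C0).
Let s' := (tperm x y * s)%g.
Let A' := A :\: [set x; y].

Let C0E : C0 = porbit s x.
Proof. exact: (cycle_listP cL (mem_head _ _) xC). Qed.

Let uCs : uniq Cs. Proof. by case/andP: cL => /andP[]. Qed.
Let C0nCs : C0 \notin Cs. Proof. by case/andP: cL => /andP[]. Qed.

Let inL C : C \in Cs -> C \in C0 :: Cs. Proof. by move=> CL; rewrite inE CL orbT. Qed.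

Lemma porbit_away z : x \notin porbit s z -> y \notin porbit s z ->
  porbit s' z = porbit s z.
Proof.
move=> xz yz; apply/esym/(eq_in_porbit (porbit_stable s z)); last exact: porbit_id.
by move=> w wz; rewrite permM tpermD //; [move: xz|move: yz]; apply: contraNneq => ->.
Qed.

Lemma x_notin C : C \in Cs -> x \notin C.
Proof.
move=> CCs; apply: contra C0nCs => xC'.
by rewrite (cycle_list_uniq cL (mem_head _ _) (inL CCs) xC xC').
Qed.

Section Merge.
Variable j : nat.
Hypotheses (ltj : j < size Cs) (yj : y \in nth set0 Cs j).
Let Cj := nth set0 Cs j.
Let CjCs : Cj \in Cs. Proof. exact: mem_nth. Qed.
Let CjE : Cj = porbit s y. Proof. exact: (cycle_listP cL (inL CjCs) yj). Qed.

Lemma merge_notin : y \notin porbit s x.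
Proof.
by rewrite porbit_sym -CjE; exact: x_notin.
Qed.

Lemma porbit_merged : porbit s' x = C0 :|: Cj.
Proof.
apply/eqP; rewrite eqEsubset; apply/andP; split.
  apply: stable_porbit_sub; last by rewrite inE xC.
  rewrite stable_tperm; last by rewrite !inE xC yj orbT.
  by apply/stableP=> z /setUP[]; rewrite C0E CjE !inE ![s z \in _](stableE _ (porbit_stable _ _)) => ->; rewrite ?orbT.
have yx' := porbit_merge merge_notin.
have st : stable s (porbit s' x).
  by rewrite -(@stable_tperm _ s _ x y) ?porbit_stable ?porbit_id ?yx'.
by rewrite subUset C0E CjE !stable_porbit_sub ?porbit_id.
Qed.

Let mem_del C : (C \in remove_at Cs j) = (C != Cj) && (C \in Cs).
Proof. by rewrite (remove_at_rem set0) // mem_rem_uniq // !inE. Qed.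

Lemma y_notin_del C : C \in remove_at Cs j -> y \notin C.
Proof.
rewrite mem_del => /andP[nC CCs]; apply: contra nC => yC; apply/eqP.
exact: (cycle_list_uniq cL (inL CCs) (inL CjCs) yC yj).
Qed.

Lemma cycle_list_merge : cycle_list s' ((C0 :|: Cj) :: remove_at Cs j).
Proof.
apply/andP; split=> /=.
  rewrite (remove_at_rem set0) // rem_uniq // andbT -remove_at_rem //.
  rewrite mem_del negb_and; apply/orP; right; apply/negP=> /x_notin.
  by rewrite inE xC.
rewrite -porbit_merged imset_f //=; apply/allP=> C CL.
have := CL; rewrite mem_del => /andP[nC CCs].
have /andP[_ /allP/(_ C (inL CCs))/imsetP[z _ EC]] := cL.
have xz := x_notin CCs; have yz := y_notin_del CL.
by rewrite EC -porbit_away -?EC //; exact: imset_f.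
Qed.

Lemma cover_merge : cover_of ((C0 :|: Cj) :: remove_at Cs j) = cover_of (C0 :: Cs).
Proof.
apply/setP=> z; apply/cover_ofP/cover_ofP=> [] [C].
  rewrite inE => /orP[/eqP->|]; last first.
    by rewrite mem_del => /andP[_ CCs] zC; exists C; rewrite ?inL.
  by case/setUP=> zC; [exists C0; rewrite ?mem_head | exists Cj; rewrite ?inL].
rewrite inE => /orP[/eqP->|CCs] zC.
  by exists (C0 :|: Cj); rewrite ?mem_head // inE zC.
have [EC|nC] := eqVneq C Cj.
  by exists (C0 :|: Cj); rewrite ?mem_head // inE -EC zC orbT.
by exists C => //; rewrite inE mem_del nC CCs orbT.
Qed.

Lemma degrees_merge : x \in A -> y \in A ->
  degrees A' ((C0 :|: Cj) :: remove_at Cs j)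
  = (#|C0 :&: A| + #|Cj :&: A| - 2) :: delete_nth (degrees A Cs) j.
Proof.
move=> xA yA; rewrite /degrees /= -[delete_nth _ _]map_remove_at; congr cons; last first.
  apply/eq_in_map=> C CL; apply: eq_card => z; rewrite !inE.
  have := CL; rewrite mem_del => /andP[nC CCs].
  have [->|_] := eqVneq z x; first by rewrite (negbTE (x_notin CCs)).
  by have [->|_] := eqVneq z y; first by rewrite (negbTE (y_notin_del CL)).
have nxy : x != y.
  by apply: contraNneq merge_notin => <-; exact: porbit_id.
have d : [disjoint C0 :&: A & Cj :&: A].
  rewrite -setI_eq0 -subset0; apply/subsetP=> z; rewrite !inE => /andP[/andP[z0 _] /andP[zj _]].
  have E := cycle_list_uniq cL (mem_head _ _) (inL CjCs) z0 zj.
  by move: C0nCs; rewrite E CjCs.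
have /eqP -> : #|C0 :&: A| + #|Cj :&: A| == #|(C0 :|: Cj) :&: A|.
  by rewrite setIUl cardsU (disjoint_setI0 d) cards0 subn0.
rewrite (@card_setD2 _ ((C0 :|: Cj) :&: A) x y) ?inE ?xC ?xA ?yj ?yA ?orbT // addnK.
by rewrite /A' setIDA.
Qed.
End Merge.

Section Split.
Hypotheses (nxy : x != y) (yx : y \in C0).
Let C1 := porbit s' x.
Let C2 := porbit s' y.

Lemma split_mem : y \in porbit s x. Proof. by rewrite -C0E. Qed.

Lemma y_notin C : C \in Cs -> y \notin C.
Proof.
move=> CCs; apply: contra C0nCs => yC'.
by rewrite (cycle_list_uniq cL (mem_head _ _) (inL CCs) yx yC').
Qed.

Lemma split_disjoint z : z \in C1 -> z \in C2 -> False.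
Proof.
move=> /porbitE E1 /porbitE E2.
by have := porbit_split nxy split_mem; rewrite -/s' -E1 E2 porbit_id.
Qed.

Lemma split_union : C1 :|: C2 = C0.
Proof.
have st0 : stable s' C0.
  by rewrite stable_tperm ?xC ?yx // C0E porbit_stable.
apply/eqP; rewrite eqEsubset subUset !stable_porbit_sub //=.
have st : stable s (C1 :|: C2).
  rewrite -(@stable_tperm _ s _ x y); last by rewrite !inE !porbit_id orbT.
  apply/stableP=> z /setUP[] H; rewrite inE (stableE _ (porbit_stable _ _)) ?H //.
  by rewrite [X in _ || X](stableE _ (porbit_stable _ _)) H orbT.
by rewrite {1}C0E stable_porbit_sub // inE porbit_id.
Qed.

Lemma porbit_split_away C : C \in Cs -> C \in porbits s'.
Proof.
move=> CCs; have /andP[_ /allP/(_ C (inL CCs))/imsetP[z _ EC]] := cL.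
have xz := x_notin CCs; have yz := y_notin CCs.
by rewrite EC -porbit_away -?EC //; exact: imset_f.
Qed.

Lemma cycle_list_sub_split L : subseq L (C1 :: C2 :: Cs) -> cycle_list s' L.
Proof.
move=> sub; have H : cycle_list s' (C1 :: C2 :: Cs).
  apply/andP; split=> /=; last first.
    by rewrite !imset_f //=; apply/allP=> C; exact: porbit_split_away.
  rewrite inE negb_or uCs andbT -andbA; apply/and3P; split.
  - by apply/eqP=> E; apply: (@split_disjoint x); rewrite -?E porbit_id.
  - by apply/negP=> /x_notin; rewrite porbit_id.
  - by apply/negP=> /y_notin; rewrite porbit_id.
case/andP: H => u a; apply/andP; split; first exact: subseq_uniq u.
by apply/allP=> C /(mem_subseq sub); exact: (allP a).
Qed.

Lemma cover_split : cover_of (C1 :: C2 :: Cs) = cover_of (C0 :: Cs).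
Proof. by apply/setP=> z; rewrite !inE /= orbA -split_union inE. Qed.

Lemma degrees_split_mask (w : bitseq) : degrees A' (mask w Cs) = mask w (degrees A Cs).
Proof.
rewrite /degrees -map_mask; apply/eq_in_map=> C /mem_mask CCs.
apply: eq_card => z; rewrite !inE.
have [->|_] := eqVneq z x; first by rewrite (negbTE (x_notin CCs)).
by have [->|_] := eqVneq z y; first by rewrite (negbTE (y_notin CCs)).
Qed.

Lemma cover_compl (w : bitseq) : size w = size Cs ->
  cover_of (C0 :: Cs) :\: cover_of (C1 :: mask w Cs) = cover_of (C2 :: mask (map negb w) Cs).
Proof.
move=> sw; apply/setP=> z; rewrite inE -cover_split.
have cl := cycle_list_sub_split (subseq_refl _).
have E C : C \in Cs -> (C \in mask (map negb w) Cs) = (C \notin mask w Cs).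
  move=> CCs; have lt : index C Cs < size w by rewrite sw index_mem.
  by rewrite !in_mask // CCs (nth_map false).
apply/andP/idP.
  case=> nz /cover_ofP[C + zC].
  rewrite 2!in_cons => /or3P[/eqP EC|/eqP EC|CCs].
  - by case/negP: nz; apply/cover_ofP; exists C; rewrite // EC mem_head.
  - by apply/cover_ofP; exists C; rewrite // EC mem_head.
  apply/cover_ofP; exists C => //; rewrite inE E // orbC; apply/orP; left.
  by apply: contra nz => Cm; apply/cover_ofP; exists C; rewrite // inE Cm orbT.
move=> /cover_ofP[C CL zC].
have CL' : C \in C1 :: C2 :: Cs.
  by move: CL; rewrite !inE => /orP[->|/mem_mask->]; rewrite !orbT.
split; last by apply/cover_ofP; exists C.
apply/negP=> /cover_ofP[C' CL2 zC'].
have CL2' : C' \in C1 :: C2 :: Cs.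
  by move: CL2; rewrite !inE => /orP[->|/mem_mask->]; rewrite ?orbT.
have EC := cycle_list_uniq cl CL' CL2' zC zC'; rewrite -{C' zC' CL2'}EC in CL2.
have /andP[/= /andP[n1 /andP[n2 _]] _] := cl; rewrite inE negb_or in n1.
move: CL CL2; rewrite !inE => /orP[/eqP->|Cm].
  by case/orP=> [/eqP E21|/mem_mask]; [rewrite -E21 eqxx in n1 | apply/negP].
case/orP=> [/eqP E1|Cm2].
  by move/mem_mask: Cm; rewrite E1; apply/negP; case/andP: n1.
by move: Cm; rewrite E ?Cm2 // (mem_mask Cm2).
Qed.

Lemma cycle_list_side (w : bitseq) : cycle_list s' (C1 :: mask w Cs).
Proof.
apply: cycle_list_sub_split; rewrite /= eqxx.
exact: subseq_trans (mask_subseq _ _) (subseq_cons _ _).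
Qed.

Lemma cycle_list_other_side (w : bitseq) : cycle_list s' (C2 :: mask w Cs).
Proof.
apply: cycle_list_sub_split; apply: subseq_trans (subseq_cons _ _).
by rewrite /= eqxx mask_subseq.
Qed.

Lemma sub_side (w : bitseq) C : C \in Cs ->
  (C \subset cover_of (C1 :: mask w Cs)) = (C \in mask w Cs).
Proof.
move=> CCs; apply/idP/idP=> [/subsetP sC|Cm]; last first.
  by apply/subsetP=> z zC; apply/cover_ofP; exists C; rewrite // inE Cm orbT.
have /imsetP[z _ EC] := porbit_split_away CCs.
have zC : z \in C by rewrite EC porbit_id.
have /cover_ofP[C' C'm zC'] := sC z zC.
have E : C' = C by rewrite EC (cycle_listP (cycle_list_side w) C'm zC').
move: C'm; rewrite E inE => /orP[/eqP E1|//].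
by have := x_notin CCs; rewrite E1 porbit_id.
Qed.

(** A stable set is a union of cycles, so that a separating one consists of the cycle
    of [x] and an arbitrary selection of the other vertices. *)
Lemma sum_separating (F : {set T} -> nat) :
  (forall Y, ~~ stable s' Y -> F Y = 0) ->
  \sum_(Y | separating (cover_of (C0 :: Cs)) x y Y) F Y =
  \sum_(w : (size Cs).-tuple bool) F (cover_of (C1 :: mask w Cs)).
Proof.
move=> F0; rewrite (bigID (stable s')) /= [X in _ + X]big1 ?addn0; last first.
  by move=> Y /andP[_ /F0].
pose h (w : (size Cs).-tuple bool) := cover_of (C1 :: mask w Cs).
pose h' (Y : {set T}) := [tuple nth set0 Cs i \subset Y | i < size Cs].
have inmask Y C : C \in Cs -> (C \in mask (h' Y) Cs) = (C \subset Y).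
  move=> CCs; have lt : index C Cs < size Cs by rewrite index_mem.
  rewrite in_mask // CCs -[index C Cs]/(val (Ordinal lt)) -tnth_nth tnth_mktuple /=.
  by rewrite nth_index.
rewrite (reindex_onto h h').
  apply: eq_bigl => w; apply/andP; split.
    rewrite (cover_stable (cycle_list_side w)) andbT; apply/and3P; split.
    - by apply/cover_ofP; exists C1; rewrite ?mem_head ?porbit_id.
    - apply/negP=> /cover_ofP[C]; rewrite inE => /orP[/eqP->|/mem_mask CCs].
        by apply/negP; exact: porbit_split nxy split_mem.
      by apply/negP; exact: y_notin.
    rewrite -cover_split; apply/subsetP=> z /cover_ofP[C CL zC].
    apply/cover_ofP; exists C => //; move: CL; rewrite !inE.
    by case/orP=> [->//|/mem_mask->]; rewrite !orbT.
  apply/eqP/eq_from_tnth=> i; rewrite tnth_mktuple.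
  have CCs : nth set0 Cs i \in Cs by rewrite mem_nth.
  by rewrite sub_side // in_mask // CCs index_uniq // (tnth_nth false).
move=> Y /andP[/and3P[xY yY sYX] stY]; apply/setP=> z; apply/cover_ofP/idP.
  case=> C; rewrite inE => /orP[/eqP->|CL] zC.
    by apply: (subsetP _ z zC); exact: stable_porbit_sub.
  by move: (CL); rewrite inmask ?(mem_mask CL) // => /subsetP; apply.
move=> zY; have := subsetP sYX z zY; rewrite -cover_split => /cover_ofP[C + zC].
rewrite !inE => /or3P[/eqP EC|/eqP EC|CCs].
- by exists C; rewrite // EC mem_head.
- case/negP: yY; move: zC; rewrite EC => /(stable_porbit stY) <-; exact: zY.
exists C => //; rewrite inE inmask // orbC; apply/orP; left.
have /imsetP[u _ EC] := porbit_split_away CCs.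
rewrite EC in zC *; apply: stable_porbit_sub => //.
by rewrite -(stable_porbit stY zC).
Qed.
End Split.
End Contraction.
End CycleLists.

(** The contribution of the loops that cut the first vertex into two vertices of
    degrees [alpha] and [beta]. *)
Definition cut_sum (v g alpha beta : nat) (mus : seq nat) : nat :=
  genus_pred (fun g' => catalan g' (alpha :: beta :: mus)) g
  + \sum_(g1 < g.+1) \sum_(g2 < g.+1 | g1 + g2 == g) \sum_(w : v.-tuple bool)
      catalan g1 (alpha :: mask w mus) * catalan g2 (beta :: mask (map negb w) mus).

(** [card_maps_contract] expressed by degrees.  All the half-edges of one vertex of
    the list give the same merged degrees, hence the factor. *)
Lemma catalan_contract (T : finType) (s : {perm T}) (A C0 : {set T}) (Cs : seq {set T})
    (x : T) g :
  cycle_list s (C0 :: Cs) -> A \subset cover_of (C0 :: Cs) -> x \in C0 -> x \in A ->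
  catalan g (degrees A (C0 :: Cs)) =
    \sum_(j < size Cs) nth 0 (degrees A Cs) j *
       catalan g ((#|C0 :&: A| + nth 0 (degrees A Cs) j - 2) :: delete_nth (degrees A Cs) j)
  + \sum_(y in C0 :&: A | x != y)
      cut_sum (size Cs) g #|porbit (tperm x y * s) x :&: (A :\: [set x; y])|
                          #|porbit (tperm x y * s) y :&: (A :\: [set x; y])| (degrees A Cs).
Proof.
move=> cL sAX xC xA; set X := cover_of (C0 :: Cs).
have C0E : C0 = porbit s x by exact: (cycle_listP cL (mem_head _ _) xC).
rewrite -(catalan_cycle_list g cL sAX) (card_maps_contract g (cover_stable cL) sAX xA).
have sA' y : A :\: [set x; y] \subset X by rewrite (subset_trans (subsetDl _ _)).
congr (_ + _).
  have inj (j j' : 'I_(size Cs)) y : y \in nth set0 Cs j -> y \in nth set0 Cs j' -> j = j'.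
    move=> yj yj'; have uC : uniq Cs by case/andP: cL => /andP[].
    apply: val_inj; apply/eqP; rewrite -(nth_uniq set0 (ltn_ord j) (ltn_ord j') uC); apply/eqP.
    by apply: (cycle_list_uniq cL _ _ yj yj'); rewrite inE mem_nth ?orbT.
  transitivity (\sum_(j < size Cs) \sum_(y in nth set0 Cs j :&: A)
      #|maps X (tperm x y * s) (A :\: [set x; y]) g|).
    rewrite (exchange_big_dep (mem A)) /=; last by move=> j y _ /setIP[].
    rewrite big_mkcondr /=; apply: eq_bigr => y yA; rewrite -C0E.
    have /cover_ofP[C + yC] := subsetP sAX y yA; rewrite inE => /orP[/eqP EC|CCs].
      rewrite -EC yC /= big1 // => j /setIP[yj _].
      by case/negP: (x_notin cL xC (mem_nth set0 (ltn_ord j))); 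
         rewrite -(cycle_list_uniq cL (mem_head _ _) _ _ yj) // -?EC // inE mem_nth ?orbT.
    have yC0 : y \notin C0.
      apply: contra (x_notin cL xC CCs) => yC0.
      by rewrite (cycle_list_uniq cL _ (mem_head _ _) yC yC0) // inE CCs orbT.
    have lt : index C Cs < size Cs by rewrite index_mem.
    have yj : y \in nth set0 Cs (Ordinal lt) by rewrite nth_index.
    rewrite yC0 (big_pred1 (Ordinal lt)) // => j.
    rewrite inE yA andbT; apply/idP/eqP => [yj'|-> //]; exact: inj yj' yj.
  apply: eq_bigr => j _.
  rewrite (nth_map set0) //.
  transitivity (\sum_(y in nth set0 Cs j :&: A)
     catalan g ((#|C0 :&: A| + #|nth set0 Cs j :&: A| - 2) :: delete_nth (degrees A Cs) j)).
    apply: eq_bigr => y /setIP[yj yA].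
    rewrite -(degrees_merge cL xC (ltn_ord j) yj xA yA) -/X.
    rewrite -(catalan_cycle_list g (cycle_list_merge cL xC (ltn_ord j) yj))
            ?(cover_merge cL (ltn_ord j)) ?sA' //.
  by rewrite sum_nat_const.
apply: eq_big => [y|y]; first by rewrite inE -C0E andbA [(y \in A) && _]andbC.
case/andP=> yA /andP[]; rewrite -C0E => yC nxy.
set s' := (tperm x y * s)%g; set A' := A :\: [set x; y].
congr (_ + _).
  case: g => //= g; rewrite /X -(cover_split cL xC yC).
  rewrite (catalan_cycle_list _ (cycle_list_sub_split cL xC nxy yC (subseq_refl _))).
  - congr catalan; rewrite /degrees /=; congr [:: _, _ & _].
    have := degrees_split_mask A cL xC yC (nseq (size Cs) true).
    by rewrite mask_true // mask_true ?size_map.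
  by rewrite (cover_split cL xC yC) sA'.
apply: eq_bigr => g1 _; apply: eq_bigr => g2 _.
rewrite (sum_separating cL xC nxy yC) => [|Y nst]; last first.
  rewrite (eq_card0 (A := maps Y _ _ _)) // => b; rewrite !inE /is_map.
  by apply/negP=> /and3P[_ /transitiveP[_ st _ _]]; rewrite st in nst.
apply: eq_bigr => w _; have sw := size_tuple w.
have E B : A' :\: B = A' :&: (X :\: B) by rewrite setIDA (setIidPl (sA' y)).
rewrite E (@cover_compl _ _ _ _ _ _ cL xC nxy yC _ sw).
rewrite (catalan_cycle_list _ (cycle_list_side cL xC nxy yC w) (subsetIr _ _)).
rewrite (catalan_cycle_list _ (cycle_list_other_side cL xC nxy yC _) (subsetIr _ _)).
rewrite !degrees_cover // /degrees /=.
by congr (catalan _ (_ :: _) * catalan _ (_ :: _)); exact: (degrees_split_mask A cL xC yC).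
Qed.

(** * The recursion for the Catalan numbers *)

Section Standard.
Variables (m : nat) (mus : seq nat).
Local Notation mu := (m :: mus).

(** A system with prescribed degrees.  Each vertex gets one passive slot, its last
    one, so that a vertex of degree 0 also is a cycle. *)
Definition slot : finType := {i : 'I_(size mu) & 'I_(nth 0 mu i).+1}%type.
Definition mk_slot (i : 'I_(size mu)) (k : 'I_(nth 0 mu i).+1) : slot :=
  Tagged (fun i : 'I_(size mu) => 'I_(nth 0 mu i).+1) k.

Definition rotate (d : slot) : slot := mk_slot (ordS (tagged d)).

Lemma rotate_inj : injective rotate.
Proof.
apply: (can_inj (g := fun d : slot => mk_slot (ord_pred (tagged d)))).
by case=> i k; rewrite /rotate /mk_slot /= ordSK.
Qed.

Definition rotation := perm rotate_inj.

Lemma rotationX n (i : 'I_(size mu)) (k : 'I_(nth 0 mu i).+1) :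
  (rotation ^+ n)%g (mk_slot k) = mk_slot (iter n (@ordS _) k).
Proof. by elim: n => [|n IHn]; rewrite ?expg0 ?perm1 // expgSr permM IHn permE. Qed.

Lemma val_iter_ordS n p (k : 'I_p) : iter n (@ordS _) k = (k + n) %% p :> nat.
Proof.
elim: n => [|n IHn]; first by rewrite addn0 modn_small.
by rewrite /= IHn -addn1 modnDml addn1 addnS.
Qed.

Definition fiber (i : 'I_(size mu)) : {set slot} := [set d : slot | tag d == i].

Lemma porbit_fiber d : porbit rotation d = fiber (tag d).
Proof.
apply/setP=> -[i' k']; case: d => i k; rewrite !inE /=; apply/porbitP/eqP.
  by case=> n; rewrite (rotationX n k) => /(congr1 tag).
move=> E; subst i'; exists (k' + ((nth 0 mu i).+1 - k)); rewrite (rotationX _ k).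
rewrite /mk_slot; congr existT; apply: val_inj => /=.
by rewrite val_iter_ordS addnCA subnKC ?modnDr ?modn_small // ltnW.
Qed.

Definition active : {set slot} := [set d : slot | tagged d < nth 0 mu (tag d)].

Definition cycle0 := fiber ord0.
Definition cycles := [seq fiber (lift ord0 i) | i <- enum 'I_(size mus)].

Lemma cycles_enum : cycle0 :: cycles = [seq fiber i | i <- enum 'I_(size mu)].
Proof. by rewrite enum_ordSl /= -map_comp. Qed.

Lemma cycle_list_standard : cycle_list rotation (cycle0 :: cycles).
Proof.
rewrite cycles_enum; apply/andP; split.
  rewrite map_inj_uniq ?enum_uniq // => i j E.
  have : mk_slot (ord0 : 'I_(nth 0 mu i).+1) \in fiber i by rewrite inE.
  by rewrite E inE => /eqP.
apply/allP=> _ /mapP[i _ ->]; apply/imsetP.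
by exists (mk_slot (ord0 : 'I_(nth 0 mu i).+1)); rewrite ?porbit_fiber.
Qed.

Lemma cover_standard : cover_of (cycle0 :: cycles) = setT.
Proof.
apply/setP=> d; rewrite cycles_enum in_setT; apply/cover_ofP; exists (fiber (tag d)).
  by rewrite map_f ?mem_enum.
by rewrite inE.
Qed.

Lemma card_interval (i : 'I_(size mu)) lo hi : hi <= (nth 0 mu i).+1 ->
  #|[set d : slot in fiber i | lo <= tagged d < hi]| = hi - lo.
Proof.
move=> le; pose f (k : 'I_(hi - lo)) := mk_slot (inord (lo + k) : 'I_(nth 0 mu i).+1).
have lt (k : 'I_(hi - lo)) : lo + k < hi by rewrite -ltn_subRL ltn_ord.
have fE k : tagged (f k) = lo + k :> nat by rewrite /= inordK // (leq_trans (lt k) le).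
have finj : injective f.
  by move=> k l E; apply/val_inj/(@addnI lo) => /=; rewrite -!fE E.
have -> : [set d : slot in fiber i | lo <= tagged d < hi] = f @: setT.
  apply/setP=> d; apply/idP/imsetP=> [|[k _ ->]]; last first.
    by rewrite !inE eqxx fE leq_addr lt.
  case: d => i' k; rewrite !inE /= => /andP[/eqP E]; subst i' => /andP[lok khi].
  have ltk : k - lo < hi - lo by rewrite ltn_sub2r // (leq_ltn_trans lok).
  exists (Ordinal ltk); rewrite // /f /mk_slot; congr existT; apply: val_inj.
  by rewrite /= subnKC // inordK.
by rewrite card_imset // cardsT card_ord.
Qed.

Lemma card_active i : #|fiber i :&: active| = nth 0 mu i.
Proof.
rewrite -[RHS]subn0 -(card_interval 0 (leqnSn _)); apply: eq_card => d; rewrite !inE.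
by case: eqP => //= <-.
Qed.

Lemma size_cycles : size cycles = size mus.
Proof. by rewrite size_map size_enum_ord. Qed.

Lemma degrees_cycles : degrees active cycles = mus.
Proof.
have sz : size (degrees active cycles) = size mus by rewrite size_map size_cycles.
apply: (@eq_from_nth _ 0) => // i; rewrite sz => lt.
rewrite (nth_map set0) ?size_cycles // (nth_map (Ordinal lt)) ?size_enum_ord //.
by rewrite card_active /= nth_enum_ord.
Qed.

Lemma degrees_standard : degrees active (cycle0 :: cycles) = mu.
Proof. by rewrite /= -/(degrees _ _) degrees_cycles card_active. Qed.

Definition corner (k : 'I_m.+1) : slot := @mk_slot ord0 k.

Hypothesis m0 : 0 < m.

Let x := corner ord0.

Section SplitStandard.
Variable k : 'I_m.+1.
Hypotheses (k0 : 0 < k) (km : k < m).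
Let y := corner k.
Let s' := (tperm x y * rotation)%g.

Definition arc lo hi : {set slot} := [set d : slot in cycle0 | lo <= tagged d < hi].

(** The loop joining slots 0 and [k] cuts the first vertex into the arc 1, ..., k
    and the arc k+1, ..., m, 0. *)
Lemma split_standard :
  porbit s' x = cycle0 :\: arc 1 k.+1 /\ porbit s' y = arc 1 k.+1.
Proof.
have xC : x \in cycle0 by rewrite inE.
have yC : y \in cycle0 by rewrite inE.
have nxy : x != y.
  apply/eqP=> /(congr1 (fun d : slot => val (tagged d))) /= E; by move: k0; rewrite -E.
have U := split_union cycle_list_standard xC yC.
have D z := @split_disjoint _ _ _ _ _ _ cycle_list_standard xC nxy yC z.
have st : stable s' (arc 1 k.+1).
  apply/stableP=> -[i l]; rewrite !inE /= => /andP[/eqP E]; subst i => /andP[l0 lk].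
  have -> : existT _ ord0 l = corner l by [].
  rewrite permM; have [El|nlk] := eqVneq (val l) (val k).
    have -> : l = k by exact: val_inj.
    by rewrite tpermR permE /= modn_small.
  have ltk : l < k by rewrite ltn_neqAle nlk.
  have inj (a b : 'I_m.+1) : val a != val b -> corner a != corner b.
    by apply: contra_neq => /(congr1 (fun d : slot => val (tagged d))).
  rewrite tpermD ?inj 1?eq_sym //; last by rewrite -lt0n.
  by rewrite permE /= modn_small ltnS // (leq_trans ltk) // ltnW.
have sy : porbit s' y \subset arc 1 k.+1.
  by rewrite stable_porbit_sub // !inE /= k0 ltnSn.
have sx : porbit s' x \subset cycle0 :\: arc 1 k.+1.
  apply: stable_porbit_sub; last by rewrite !inE.
  apply: stableD st; rewrite stable_tperm ?xC //.
  by rewrite -[cycle0](porbit_fiber x) porbit_stable.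
have arcC : arc 1 k.+1 \subset cycle0 by apply/subsetP=> z; rewrite inE => /andP[].
split; apply/eqP; rewrite eqEsubset ?sx ?sy /=; apply/subsetP=> z.
  case/setDP=> zC nz; move: zC; rewrite -U => /setUP[//|/(subsetP sy)].
  by rewrite (negbTE nz).
move=> za; have := subsetP arcC z za; rewrite -U => /setUP[/(subsetP sx)|//].
by rewrite inE za.
Qed.

Lemma card_split_standard :
  #|porbit s' x :&: (active :\: [set x; y])| = m - 1 - k /\
  #|porbit s' y :&: (active :\: [set x; y])| = k - 1.
Proof.
have [-> ->] := split_standard.
have tE (d : slot) (a : 'I_m.+1) : tag d = ord0 -> (d == corner a) = (tagged d == a :> nat).
  case: d => i l /= E; subst i; apply/eqP/eqP => [/(congr1 (fun d : slot => val (tagged d)))//|El].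
  by congr existT; exact: val_inj.
split.
  have -> : (cycle0 :\: arc 1 k.+1) :&: (active :\: [set x; y]) = arc k.+1 m.
    apply/setP=> d; rewrite !inE; have [E|_] := eqVneq (tag d) ord0; last by rewrite /= ?andbF.
    rewrite !tE //; move: (nat_of_ord (tagged d)) => l; rewrite E /=; clear -k0 km.
    by lia.
  by rewrite card_interval //= subnS -subn1 subnAC.
have -> : arc 1 k.+1 :&: (active :\: [set x; y]) = arc 1 k.
  apply/setP=> d; rewrite !inE; have [E|//] := eqVneq (tag d) ord0.
  rewrite !tE //; move: (nat_of_ord (tagged d)) => l; rewrite E /=; clear -k0 km.
  by lia.
by rewrite card_interval //= ltnW // ltnW.
Qed.

End SplitStandard.

Theorem catalan_recursion g :
  catalan g mu =
    \sum_(j < size mus) nth 0 mus j * catalan g ((m + nth 0 mus j - 2) :: delete_nth mus j)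
  + \sum_(k < m.-1) cut_sum (size mus) g (m - 2 - k) k mus.
Proof.
have xC : x \in cycle0 by rewrite inE.
have xA : x \in active by rewrite inE.
have sA : active \subset cover_of (cycle0 :: cycles) by rewrite cover_standard subsetT.
have := catalan_contract g cycle_list_standard sA xC xA.
rewrite degrees_standard degrees_cycles size_cycles card_active => ->; congr (_ + _).
(* the possible partners of x in its own vertex are the slots 1, ..., m - 1 *)
pose f (k : 'I_m.-1) := corner (inord k.+1).
have ltk (k : 'I_m.-1) : k.+1 < m by rewrite -ltn_predRL.
have fE k : tagged (f k) = k.+1 :> nat by rewrite /= inordK // ltnS ltnW.
have finj : injective f.
  by move=> k l E; apply/val_inj/succn_inj; rewrite -!fE E.
rewrite (eq_bigl (mem (f @: setT))) => [|y]; last first.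
  rewrite !inE; apply/idP/imsetP=> [|[k _ ->]]; last first.
    rewrite fE ltk eqxx /=; apply/eqP=> /(congr1 (fun d : slot => val (tagged d))).
    by rewrite [RHS]fE.
  case: y => i l /= /andP[/andP[/eqP E lm]]; subst i => nx.
  have l0 : 0 < l.
    rewrite lt0n; apply: contra nx => /eqP El; apply/eqP.
    by congr existT; apply: val_inj.
  have lt : l.-1 < m.-1 by rewrite -ltnS !prednK.
  exists (Ordinal lt) => //; rewrite /f /corner /mk_slot; congr existT; apply: val_inj.
  by rewrite /= prednK // inordK.
rewrite big_imset /=; last by move=> k l _ _; exact: finj.
apply: eq_big => [k|k _]; first by rewrite inE.
have k0 : 0 < (inord k.+1 : 'I_m.+1) by rewrite inordK // ltnS ltnW.
have km : (inord k.+1 : 'I_m.+1) < m by rewrite inordK // ltnS ltnW.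
have [-> ->] := card_split_standard k0 km.
rewrite inordK ?ltnS 1?ltnW //; congr cut_sum; last by rewrite subn1.
by rewrite -!subnDA; congr (_ - _).
Qed.
End Standard.

(** * The binomial transform *)

Local Open Scope ring_scope.

Section Transform.
Variables (R : comNzRingType) (b c : R).
Implicit Types (H G : nat -> R) (F : seq nat -> R).

(** The functional sending [H] to the sum of 'C(n, k) b^(n-k) c^k H(k), see
    [binomial_transformE].  In this form it is the [n]-th power of the operator
    b + c * shift followed by evaluation at 0, and each identity below is a
    short induction on [n] instead of an identity between binomial
    coefficients. *)
Fixpoint binomial_transform n H : R :=
  if n is n'.+1 then
    b * binomial_transform n' H + c * binomial_transform n' (fun k => H k.+1)
  else H 0%N.
Local Notation bt := binomial_transform.

Lemma eq_binomial_transform n H G : H =1 G -> bt n H = bt n G.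
Proof.
elim: n H G => [|n IHn] H G E /=; first exact: E.
by congr (_ * _ + _ * _); apply: IHn => k; exact: E.
Qed.

Lemma bt_add n H G : bt n (fun k => H k + G k) = bt n H + bt n G.
Proof. by elim: n H G => [|n IHn] H G //=; rewrite IHn (IHn (fun k => H k.+1)); ring. Qed.

Lemma bt_scale n a H : bt n (fun k => a * H k) = a * bt n H.
Proof. by elim: n H => [|n IHn] H //=; rewrite IHn (IHn (fun k => H k.+1)); ring. Qed.

Lemma bt_sum n (I : Type) (r : seq I) (P : pred I) (H : I -> nat -> R) :
  bt n (fun k => \sum_(i <- r | P i) H i k) = \sum_(i <- r | P i) bt n (H i).
Proof.
elim: n H => [|n IHn] H //=; rewrite IHn (IHn (fun i k => H i k.+1)).
by rewrite !big_distrr -big_split.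
Qed.

Lemma binomial_transformE n H : bt n H = \sum_(k < n.+1) ('C(n, k)%:R * b ^+ (n - k) * c ^+ k) * H k.
Proof.
elim: n H => [|n IHn] H /=; first by rewrite big_ord1 bin0 !expr0 !mul1r.
rewrite !IHn [RHS]big_ord_recl /= bin0 subn0 expr0.
under [X in _ = _ + X]eq_bigr => k _.
  rewrite /bump /= add1n binS natrD subSS.
  have -> : ('C(n, k.+1)%:R + 'C(n, k)%:R) * b ^+ (n - k) * c ^+ k.+1 * H k.+1 =
     'C(n, k.+1)%:R * b ^+ (n - k) * c ^+ k.+1 * H k.+1 +
     c * ('C(n, k)%:R * b ^+ (n - k) * c ^+ k * H k.+1) by rewrite exprS; ring.
  over.
rewrite big_split /= -big_distrr addrA; congr (_ + _).
rewrite big_ord_recl /= bin0 subn0 expr0 mulrDr big_ord_recr /= bin_small // !mul0r addr0.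
congr (_ + _); first by rewrite exprS; ring.
rewrite big_distrr; apply: eq_bigr => k _ /=; rewrite /bump /= add1n.
have -> : (n - k = (n - k.+1).+1)%N by rewrite subnSK.
by rewrite (exprS b); ring.
Qed.

Lemma bt_swap n m (H : nat -> nat -> R) :
  bt n (fun k => bt m (fun l => H k l)) = bt m (fun l => bt n (fun k => H k l)).
Proof.
elim: n H => [|n IHn] H //=.
by rewrite (bt_add m (fun l => b * _)) !bt_scale IHn (IHn (fun k l => H k.+1 l)).
Qed.

(** Vandermonde convolution. *)
Lemma bt_addn n m H : bt (n + m) H = bt n (fun k => bt m (fun l => H (k + l)%N)).
Proof. by elim: n H => [|n IHn] H //=; rewrite !IHn. Qed.

(** Absorption: k 'C(n, k) = n 'C(n-1, k-1). *)
Lemma bt_natmul n H : bt n (fun k => k%:R * H k) = n%:R * c * bt n.-1 (fun k => H k.+1).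
Proof.
elim: n H => [|n IHn] H /=; first by rewrite !mul0r.
rewrite IHn (@eq_binomial_transform n _ (fun k => k%:R * H k.+1 + H k.+1)) => [|k]; last by rewrite -natr1 mulrDl mul1r.
rewrite bt_add IHn; case: n {IHn} => [|n] /=; first by ring.
by rewrite -!natr1; ring.
Qed.

(** The binomial identity behind this is that 'C(n, p+q+1) is the sum of
    'C(z, p) 'C(i, q) over z + i = n - 1.  The induction on [n] applies the
    operator b + c * shift: shifting a convolution shifts its first factor, up to
    the boundary term f 0 k. *)
Lemma bt_conv n (f : nat -> nat -> R) :
  bt n (fun k => \sum_(i < k) f (k - 1 - i)%N i) =
  c * \sum_(i < n) bt (n - 1 - i) (fun p => bt i (fun q => f p q)).
Proof.
elim: n f => [|n IHn] f /=; first by rewrite !big_ord0 mulr0.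
rewrite IHn.
rewrite (@eq_binomial_transform n _ (fun k => (\sum_(i < k) f (k - 1 - i).+1 i) + f 0%N k)) => [|k]; last first.
  rewrite big_ord_recr /= subSS subn0 subnn; congr (_ + _); apply: eq_bigr => i _.
  by rewrite -subnDA add1n subnSK.
rewrite bt_add (IHn (fun p q => f p.+1 q)) big_ord_recr /= subSS subn0 subnn /=.
have -> : \sum_(i < n) bt (n - i) (fun p => bt i (fun q => f p q)) =
    b * (\sum_(i < n) bt (n - 1 - i) (fun p => bt i (fun q => f p q)))
    + c * (\sum_(i < n) bt (n - 1 - i) (fun p => bt i (fun q => f p.+1 q))).
  rewrite !big_distrr -big_split; apply: eq_bigr => i _.
  by rewrite -subnDA add1n -(subnSK (ltn_ord i)).
by ring.
Qed.

Fixpoint multi_transform (ns : seq nat) F : R :=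
  if ns is n :: ns' then bt n (fun k => multi_transform ns' (fun mu => F (k :: mu)))
  else F [::].
Local Notation mt := multi_transform.

Lemma eq_multi_transform ns F F' : (forall mu, size mu = size ns -> F mu = F' mu) -> mt ns F = mt ns F'.
Proof.
elim: ns F F' => [|n ns IHns] F F' E /=; first exact: E.
by apply: eq_binomial_transform => k; apply: IHns => mu smu; apply: E; rewrite /= smu.
Qed.

Lemma mt_add ns F F' : mt ns (fun mu => F mu + F' mu) = mt ns F + mt ns F'.
Proof.
elim: ns F F' => [|n ns IHns] F F' //=; rewrite -bt_add; apply: eq_binomial_transform => k; exact: IHns.
Qed.

Lemma mt_scale ns a F : mt ns (fun mu => a * F mu) = a * mt ns F.
Proof.
elim: ns F => [|n ns IHns] F //=; rewrite -bt_scale; apply: eq_binomial_transform => k; exact: IHns.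
Qed.

Lemma mt_sum ns (I : Type) (r : seq I) (P : pred I) (F : I -> seq nat -> R) :
  mt ns (fun mu => \sum_(i <- r | P i) F i mu) = \sum_(i <- r | P i) mt ns (F i).
Proof.
elim: ns F => [|n ns IHns] F //=; rewrite -bt_sum; apply: eq_binomial_transform => k.
exact: (IHns (fun i mu => F i (k :: mu))).
Qed.

Lemma mt_delete ns j (F : nat -> seq nat -> R) : (j < size ns)%N ->
  mt ns (fun mu => F (nth 0%N mu j) (delete_nth mu j)) =
  bt (nth 0%N ns j) (fun l => mt (delete_nth ns j) (F l)).
Proof.
elim: ns j F => [//|n ns IHns] [|j] F ltj.
  rewrite /= /delete_nth /= drop0; apply: eq_binomial_transform => k; apply: eq_multi_transform => mu _.
  by rewrite drop0.
rewrite /= bt_swap; apply: eq_binomial_transform => k.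
exact: (IHns j (fun l mu => F l (k :: mu))).
Qed.

(** The two factors depend on complementary sets of variables. *)
Lemma mt_mask ns (w : bitseq) F F' : size w = size ns ->
  mt ns (fun mu => F (mask w mu) * F' (mask (map negb w) mu)) =
  mt (mask w ns) F * mt (mask (map negb w) ns) F'.
Proof.
elim: ns w F F' => [|n ns IHns] [|[] w] F F' //= [sw].
  rewrite mulrC -bt_scale; apply: eq_binomial_transform => k.
  by rewrite (IHns w (fun mu => F (k :: mu))) // mulrC.
by rewrite -bt_scale; apply: eq_binomial_transform => k; exact: (IHns w F (fun mu => F' (k :: mu))).
Qed.

Lemma eq_sum_upto (n : seq nat) (F G : seq nat -> R) :
  (forall mu, (sumn mu <= sumn n)%N -> F mu = G mu) -> sum_upto n F = sum_upto n G.
Proof.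
elim: n F G => [|m n IHn] F G E /=; first exact: E.
apply: eq_bigr => k _; apply: IHn => mu le; apply: E.
by rewrite /= leq_add // -ltnS.
Qed.

Lemma sum_upto_scale (n : seq nat) a (F : seq nat -> R) :
  sum_upto n (fun mu => a * F mu) = a * sum_upto n F.
Proof.
elim: n F => [|m n IHn] F //=; rewrite big_distrr; apply: eq_bigr => k _; exact: IHn.
Qed.

Lemma multi_transformE (n : seq nat) F :
  sum_upto n (fun mu => (\prod_(i < size n) 'C(nth 0%N n i, nth 0%N mu i))%N%:R
    * F mu * b ^+ (sumn n - sumn mu) * c ^+ sumn mu) = mt n F.
Proof.
elim: n F => [|m n IHn] F /=; first by rewrite big_ord0 !mul1r subn0 !expr0 !mulr1.
rewrite binomial_transformE; apply: eq_bigr => k _; rewrite -IHn -sum_upto_scale.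
apply: eq_sum_upto => mu le; rewrite big_ord_recl /= natrM.
have -> : (m + sumn n - (k + sumn mu) = (m - k) + (sumn n - sumn mu))%N.
  by have := ltn_ord k; move: (sumn n) (sumn mu) (val k) le; clear; lia.
by rewrite !exprD; ring.
Qed.

End Transform.

(** * Transport of the recursion *)

Section Motzkin.
Variables (R : realType) (b c : R).
Local Notation bt := (binomial_transform b c).
Local Notation mt := (multi_transform b c).

Lemma motzkinE g n : motzkin b c g n = mt n (fun mu => (catalan g mu)%:R).
Proof. exact: multi_transformE. Qed.

Lemma sum_subtuple (V : nmodType) (ns : seq nat) (F : seq nat -> seq nat -> V) :
  \sum_(I : {set 'I_(size ns)}) F (subtuple I) (subtuple (~: I)) =
  \sum_(w : (size ns).-tuple bool) F (mask w ns) (mask (map negb w) ns).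
Proof.
have E (w : (size ns).-tuple bool) : subtuple [set i | tnth w i] = mask w ns.
  rewrite /subtuple /enum_mem -enumT filter_mask map_mask; congr mask.
    rewrite -[RHS]map_tnth_enum; apply: eq_map => i; exact: in_set.
  by rewrite (map_comp (nth 0%N ns) val) val_enum_ord map_nth_iota0 // take_size.
pose h (w : (size ns).-tuple bool) := [set i | tnth w i].
have hK : cancel h (fun I : {set _} => [tuple i \in I | i < size ns]).
  by move=> w; apply: eq_from_tnth => i; rewrite tnth_mktuple inE.
have hK' : cancel (fun I : {set _} => [tuple i \in I | i < size ns]) h.
  by move=> I; apply/setP=> i; rewrite inE tnth_mktuple.
rewrite (reindex h); last by apply: onW_bij; exists (fun I : {set _} => [tuple i \in I | i < size ns]).
apply: eq_bigr => w _; rewrite E; congr F.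
rewrite -[map negb w]/(tval (map_tuple negb w)) -E; congr subtuple.
by apply/setP=> i; rewrite !inE tnth_map.
Qed.

Lemma sum_antidiagonal_pred (V : nmodType) n (F : nat -> nat -> V) :
  \sum_(i < n.+1) \sum_(j < n.+1 | (i + j + 2 == n.+1)%N) F i j =
  \sum_(j < n) F (n - 1 - j)%N j.
Proof.
rewrite (exchange_big_dep predT) //= big_ord_recr /= [X in _ + X]big1 ?addr0 => [|i /eqP E]; last first.
  by exfalso; move: (val i) E => /= i'; clear; lia.
apply: eq_bigr => j _.
have lt : (n - 1 - j < n.+1)%N by rewrite -subnDA ltnS leq_subr.
rewrite (big_pred1 (Ordinal lt)) // => i /=; rewrite -val_eqE /=.
by move: (val i) (val j) (ltn_ord j); clear => i' j' ltj; apply/eqP/eqP; lia.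
Qed.

(** The transform is linear, and it is multiplicative on functions of disjoint sets
    of variables.  The masks [true :: false :: w] and its complement select the
    variables of the two factors. *)
Lemma motzkin_cut_sum g p q (ns : seq nat) :
  bt p (fun alpha => bt q (fun beta =>
    mt ns (fun mu => (cut_sum (size ns) g alpha beta mu)%:R))) =
  motzkin_pred b c g (p :: q :: ns)
  + \sum_(g1 < g.+1) \sum_(g2 < g.+1 | (g1 + g2 == g)%N) \sum_(I : {set 'I_(size ns)})
      motzkin b c g1 (p :: subtuple I) * motzkin b c g2 (q :: subtuple (~: I)).
Proof.
transitivity (mt (p :: q :: ns) (fun nu => (cut_sum (size ns) g (nth 0%N nu 0)
    (nth 0%N nu 1) (drop 2 nu))%:R)).
  by apply: eq_binomial_transform => alpha; apply: eq_binomial_transform => beta; apply: eq_multi_transform => mu _; rewrite /= drop0.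
rewrite (@eq_multi_transform _ b c _ _ (fun nu =>
    (genus_pred (fun g' => catalan g' nu) g)%:R
    + \sum_(g1 < g.+1) \sum_(g2 < g.+1 | (g1 + g2 == g)%N) \sum_(w : (size ns).-tuple bool)
      (catalan g1 (mask (true :: false :: w) nu))%:R
      * (catalan g2 (mask (map negb (true :: false :: w)) nu))%:R)); last first.
  case=> [|alpha [|beta mu]] //= _; rewrite drop0 /cut_sum natrD natr_sum; congr (_ + _).
  apply: eq_bigr => g1 _; rewrite natr_sum; apply: eq_bigr => g2 _; rewrite natr_sum.
  by apply: eq_bigr => w _; rewrite natrM.
rewrite mt_add; congr (_ + _).
  case: g => [|g] /=; last by rewrite motzkinE.
  by rewrite -[LHS]/(mt (p :: q :: ns) (fun=> 0)) -(mul0r 0) mt_scale !mul0r.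
rewrite mt_sum; apply: eq_bigr => g1 _; rewrite mt_sum; apply: eq_bigr => g2 _.
rewrite (sum_subtuple ns (fun u v => motzkin b c g1 (p :: u) * motzkin b c g2 (q :: v))).
rewrite mt_sum; apply: eq_bigr => w _.
rewrite (mt_mask b c (fun nu => (catalan g1 nu)%:R) (fun nu => (catalan g2 nu)%:R)).
  by rewrite !motzkinE.
by rewrite /= size_tuple.
Qed.
End Motzkin.

Theorem theorem1p3 (R : realType) (b c : R) (hb : 0 <= b) (hc : 0 < c)
    (g n1 : nat) (hn1 : (1 <= n1)%N) (ns : seq nat) :
  motzkin b c g (n1 :: ns) - b * motzkin b c g ((n1 - 1)%N :: ns) =
  c ^+ 2 *
    (\sum_(j < size ns)
        (nth 0%N ns j)%:R *
        motzkin b c g ((n1 + nth 0%N ns j - 2)%N :: delete_nth ns j)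
     + \sum_(zeta < n1) \sum_(xi < n1 | (zeta + xi + 2 == n1)%N)
        (motzkin_pred b c g ((zeta : nat) :: (xi : nat) :: ns)
         + \sum_(g1 < g.+1) \sum_(g2 < g.+1 | (g1 + g2 == g)%N)
             \sum_(I : {set 'I_(size ns)})
               motzkin b c g1 ((zeta : nat) :: subtuple I)
               * motzkin b c g2 ((xi : nat) :: subtuple (~: I)))).
Proof.
(* the term b * motzkin is the first half of the recursive step of the transform *)
case: n1 hn1 => [//|n] _; rewrite subSS subn0 !motzkinE /= [_ + _ - _]addrAC subrr add0r.
rewrite (sum_antidiagonal_pred _ (fun zeta xi => motzkin_pred b c g (zeta :: xi :: ns)
         + \sum_(g1 < g.+1) \sum_(g2 < g.+1 | (g1 + g2 == g)%N)
             \sum_(I : {set 'I_(size ns)})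
               motzkin b c g1 (zeta :: subtuple I)
               * motzkin b c g2 (xi :: subtuple (~: I)))).
set bt := binomial_transform b c; set mt := multi_transform b c.
rewrite expr2 -mulrA; congr (_ * _).
(* the two halves of catalan_recursion, merging and cutting *)
pose A k mu : R := \sum_(j < size ns) (nth 0%N mu j)%:R *
  (catalan g ((k.+1 + nth 0%N mu j - 2)%N :: delete_nth mu j))%:R.
pose B k mu : R := \sum_(i < k) (cut_sum (size ns) g (k - 1 - i) i mu)%:R.
have -> : bt n (fun k => mt ns (fun mu => (catalan g (k.+1 :: mu))%:R)) =
    bt n (fun k => mt ns (A k)) + bt n (fun k => mt ns (B k)).
  rewrite -bt_add; apply: eq_binomial_transform => k; rewrite -mt_add; apply: eq_multi_transform => mu smu.
  rewrite catalan_recursion // natrD !natr_sum smu; congr (_ + _).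
  by apply: eq_bigr => j _; rewrite natrM.
rewrite mulrDr; congr (_ + _).
  have -> : bt n (fun k => mt ns (A k)) = \sum_(j < size ns) bt n (fun k => mt ns (fun mu =>
      (nth 0%N mu j)%:R * (catalan g ((k.+1 + nth 0%N mu j - 2)%N :: delete_nth mu j))%:R)).
    by rewrite -bt_sum; apply: eq_binomial_transform => k; rewrite -mt_sum.
  rewrite big_distrr; apply: eq_bigr => j _ /=; rewrite motzkinE.
  pose G k := mt (delete_nth ns j) (fun nu => (catalan g (k :: nu))%:R).
  have -> : bt n (fun k => mt ns (fun mu =>
      (nth 0%N mu j)%:R * (catalan g ((k.+1 + nth 0%N mu j - 2)%N :: delete_nth mu j))%:R)) =
      (nth 0%N ns j)%:R * c * bt n (fun k => bt (nth 0%N ns j).-1 (fun l => G (k + l)%N)).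
    (* absorption leaves n_j - 1, so that Vandermonde gives n + n_j - 1 = n1 + n_j - 2 *)
    rewrite -bt_scale; apply: eq_binomial_transform => k.
    rewrite [LHS](mt_delete b c (fun l nu =>
      l%:R * (catalan g ((k.+1 + l - 2)%N :: nu))%:R) (ltn_ord j)).
    have -> : bt (nth 0%N ns j).-1 (fun l => G (k + l)%N) =
        bt (nth 0%N ns j).-1 (fun l => G (k.+1 + l.+1 - 2)%N).
      by apply: eq_binomial_transform => l; rewrite addSn addnS subn2.
    rewrite -[RHS](bt_natmul b c _ (fun l => G (k.+1 + l - 2)%N)).
    by apply: eq_binomial_transform => l; rewrite /G -mt_scale.
  rewrite mulrA [_ * c]mulrC; case: (nth 0%N ns j) => [|l]; first by rewrite !(mulr0, mul0r).
  by rewrite /= /bt -(bt_addn b c n l G) addSn addnS subn2.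
have -> : bt n (fun k => mt ns (B k)) = bt n (fun k => \sum_(i < k)
    mt ns (fun mu => (cut_sum (size ns) g (k - 1 - i) i mu)%:R)).
  by apply: eq_binomial_transform => k; rewrite -mt_sum.
rewrite [LHS](bt_conv b c n (fun p q => mt ns (fun mu => (cut_sum (size ns) g p q mu)%:R))).
by congr (_ * _); apply: eq_bigr => i _; exact: motzkin_cut_sum.
Qed.
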